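(* Let $n$ be a positive even integer and let $\alpha\in(0,1)$. Let $X_1,\ldots,X_n$ be independent random vectors in $\mathbb{R}^d$ such that for all $i\in\{1,\dots,n\}$ $$\sup_{x\in\mathbb{R}^d}\mathbb{P}(X_i=x)\le\alpha.$$ Then for every $x\in\mathbb{R}^d$ $$\mathbb{P}(X_1+\cdots+X_n=x)\le\mathbb{P}(U_1^\alpha-U_2^\alpha+\cdots+U_{n-1}^\alpha-U_n^\alpha=0),$$ where $U_1^\alpha,\dots,U_n^\alpha$ are independent identically distributed copies of the random variable $U^\alpha$.
   Context: For $\alpha\in(0,1)$, $U^\alpha$ denotes an integer-valued random variable with $\mathbb{P}(U^\alpha=l)=\alpha$ for $l=0,1,\ldots,\lfloor 1/\alpha\rfloor-1$ and $\mathbb{P}(U^\alpha=\lfloor 1/\alpha\rfloor)=1-\alpha\lfloor 1/\alpha\rfloor$. *)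

(* Defs.v *)
From HB Require Import structures.
From mathcomp Require Import all_boot all_order all_algebra.
From mathcomp Require Import all_classical all_reals all_analysis.

Set Implicit Arguments.
Unset Strict Implicit.
Unset Printing Implicit Defensive.

Import Order.TTheory GRing.Theory Num.Theory.
Import numFieldNormedType.Exports.

Local Open Scope classical_set_scope.
Local Open Scope ring_scope.

(* Row vectors 'rV[R]_d with the Borel sigma-algebra of the product topology. *)
Definition borel_vector (R : realType) (d : nat) : measurableType _ :=
  g_sigma_algebraType (@open 'rV[R]_d).

HB.instance Definition _ := isPointed.Build int 0.

HB.instance Definition _ := @isMeasurable.Build default_measure_display
  int discrete_measurable discrete_measurable0
  discrete_measurableC discrete_measurableU.

Definition mutually_independent (dO dT : measure_display)
    (Omega : measurableType dO) (T : measurableType dT) (R : realType)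
    (P : probability Omega R) (I : finType) (X : I -> {RV P >-> T}) : Prop :=
  forall (J : {set I}) (A : I -> set T),
    (forall i, i \in J -> measurable (A i)) ->
    P (\bigcap_(i in [set` J]) (X i @^-1` A i)) =
    (\prod_(i in J) P (X i @^-1` A i))%E.

(* The masses below add up to 1, so they determine the law of U although U may
   take other integer values on a null set. *)
Definition has_law_U (dO : measure_display) (Omega : measurableType dO)
    (R : realType) (P : probability Omega R) (alpha : R)
    (U : {RV P >-> int}) : Prop :=
  let N := Num.floor alpha^-1 in
  (forall l : int, 0 <= l <= N - 1 -> P [set w | U w = l] = alpha%:E) /\
  P [set w | U w = N] = (1 - alpha * N%:~R)%:E.

(* Main.v *)
(* By independence of the two halves, P(A + B = x) is at most the mean of the
   probabilities of A = A' and B = B', with A', B' independent copies. This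
   turns the sum into a sum of n/2 symmetric variables X_i - X_i'. For finitely
   supported laws on an ordered abelian group one shows, by induction on the number
   of terms, that such a sum puts at most as much mass on any 2k+1 points as the
   corresponding sum of the U_i - U_i' puts on the interval [-k, k]. The induction
   step is a rearrangement inequality, which by summation by parts reduces to
   counting the pairs (a, b) in A x B with a + b in S: deleting the least element
   of A and the greatest of B removes |A| + |B| - 1 pairs with distinct sums.
   The lexicographic order makes row vectors an ordered group. For general laws,
   only the finitely many atoms of mass greater than eps are kept: conditionally on
   the other variables, X_i = x - (their sum) with X_i not among those atoms has
   probability at most eps. *)
Require Import Defs.
From HB Require Import structures.
From mathcomp Require Import all_boot all_order all_algebra zify ring lra.
From mathcomp Require Import all_classical all_reals all_analysis measurable_realfun.

Set Implicit Arguments.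
Unset Strict Implicit.
Unset Printing Implicit Defensive.

Import Order.TTheory GRing.Theory Num.Theory.
Import numFieldNormedType.Exports.

Local Open Scope ring_scope.

(** * The zigzag order of the integers *)

(* Enumerates the integers as 0, 1, -1, 2, -2, ...: initial segments are intervals. *)
Definition zigzag (i : nat) : int := if odd i then i.+1./2%:Z else - i./2%:Z.

Definition zigzag_near (k i j : nat) : bool := `|zigzag i - zigzag j| <= k%:Z.

(** The first [p] zigzag values fill the interval from [1 - p.+1./2] to [p./2]; the right side
    counts the integers that it shares with the interval of radius [k] about [t]. *)
Lemma count_zigzag_ball (k p : nat) (t : int) :
  ((\sum_(i < p) (`|zigzag i - t| <= k%:Z)%R)%N)%:Z =
  Num.max 0 (Num.min p./2%:Z (t + k%:Z) - Num.max (1 - p.+1./2%:Z) (t - k%:Z) + 1).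
Proof.
elim: p => [|p IH]; first by rewrite big_ord0; lia.
rewrite big_ord_recr /= PoszD IH /zigzag.
have := odd_double_half p; rewrite uphalf_half.
case: (odd p) => /= Hp; set m := p./2 in Hp *.
- case: (boolP (`|_| <= _)); lia.
- case: (boolP (`|_| <= _)); lia.
Qed.

(** After reflecting one arm when [p] and [q] differ in parity, the differences along the hook are
    [p + q + 1] consecutive integers, balanced around 0 up to one unit. This is the equality case of
    the hook bound for sumsets. *)
Lemma zigzag_hook (k p q : nat) :
  (\sum_(i < p.+1) zigzag_near k i q + \sum_(j < q) zigzag_near k p j)%N
  = minn k.*2.+1 (p + q).+1.
Proof.
have -> : (\sum_(j < q) zigzag_near k p j =
          \sum_(j < q) (`|zigzag j - zigzag p| <= k%:Z)%R)%N.
  by apply: eq_bigr => j _; rewrite /zigzag_near distrC.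
apply/eqP; rewrite -eqz_nat PoszD !count_zigzag_ball /zigzag /= !uphalf_half.
have := odd_double_half q; have := odd_double_half p.
case: (odd p) => /= Hp; case: (odd q) => /= Hq;
  set m := p./2 in Hp *; set m' := q./2 in Hq *; apply/eqP; lia.
Qed.

(** * Counting sums in an ordered group *)

(** A bare relation, so that the same lemmas serve [int] with its usual order and row vectors with
    the lexicographic one. *)
Definition group_order (G : zmodType) (lt : rel G) : Prop :=
  [/\ irreflexive lt, transitive lt, forall x y, x != y -> lt x y || lt y x &
      forall z x y, lt x y -> lt (x + z) (y + z)].

Lemma count_mem_uniq_le (T : eqType) (s S : seq T) :
  uniq s -> (\sum_(x <- s) (x \in S) <= minn (size S) (size s))%N.
Proof.
move=> us.
have -> : (\sum_(x <- s) (x \in S) = count (mem S) s)%N.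
  by rewrite -sum1_count [RHS]big_mkcond; apply: eq_bigr => x _ /=; case: (x \in S).
rewrite leq_min count_size andbT -size_filter uniq_leq_size ?filter_uniq //.
by move=> x; rewrite mem_filter => /andP[].
Qed.

(** Removing the heads [a] of [A] and [b] of [B] removes a hook of pairs with distinct sums, because
    [B] decreases: [a + y < a + b < x + b]. At most [minn k.*2.+1 (size A + size B - 1)] of these
    sums lie in [S], and by [zigzag_hook] the hook removed on the right contributes exactly that
    number. *)
Lemma sorted_sumset_count (G : zmodType) (lt : rel G) (k : nat) (A B S : seq G) :
  group_order lt -> (size S <= k.*2.+1)%N ->
  sorted lt A -> sorted (fun x y => lt y x) B ->
  (\sum_(a <- A) \sum_(b <- B) ((a + b)%R \in S)
   <= \sum_(i < size A) \sum_(j < size B) zigzag_near k i j)%N.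
Proof.
move=> [irr tr _ add] sS; elim: A B => [|a A IH] B sA sB; first by rewrite big_nil.
case: B sB => [|b B] sB.
  by rewrite big1_seq // => i _; rewrite big_nil.
have tr' : transitive (fun x y => lt y x) by move=> x y z /[swap]; apply: tr.
have aA := order_path_min tr sA; have bB := order_path_min tr' sB.
have uA : uniq A by apply: (sorted_uniq tr irr); apply: path_sorted sA.
have uB : uniq B by apply: (sorted_uniq tr' irr); apply: path_sorted sB.
(* The sums in [a + B], [a + b] and [A + b] are pairwise distinct. *)
pose hook := (a + b) :: [seq a + y | y <- B] ++ [seq x + b | x <- A].
have ulo y : y \in B -> lt (a + y) (a + b).
  by move=> yB; rewrite ![a + _]addrC add // (allP bB).
have uhi x : x \in A -> lt (a + b) (x + b) by move=> xA; rewrite add // (allP aA).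
have uhook : uniq hook.
  rewrite /hook cons_uniq cat_uniq !map_inj_uniq ?uA ?uB /=; [|exact: addIr|exact: addrI].
  rewrite mem_cat negb_or andbT; apply/andP; split.
  - apply/andP; split; apply/negP => /mapP[z zin e].
      by have := ulo z zin; rewrite -e irr.
    by have := uhi z zin; rewrite -e irr.
  - apply/hasPn => z /mapP[x xA ->]; apply/negP => /mapP[y yB e].
    by have := tr _ _ _ (ulo y yB) (uhi x xA); rewrite e irr.
have hk := count_mem_uniq_le S uhook.
rewrite /hook big_cons big_cat /= !big_map size_cat !size_map in hk.
rewrite big_cons big_cons.
under [X in (_ + X <= _)%N]eq_bigr do rewrite big_cons.
rewrite big_split /= big_ord_recr /=.
under [X in (_ <= X + _)%N]eq_bigr do rewrite big_ord_recr /=.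
rewrite big_split /=.
have := IH B (path_sorted sA) (path_sorted sB).
have := zigzag_hook k (size A) (size B).
rewrite !big_ord_recr /=.
lia.
Qed.

Lemma sumset_count (G : zmodType) (lt : rel G) (k : nat) (A B S : seq G) :
  group_order lt -> uniq A -> uniq B -> (size S <= k.*2.+1)%N ->
  (\sum_(a <- A) \sum_(b <- B) ((a + b)%R \in S)
   <= \sum_(i < size A) \sum_(j < size B) zigzag_near k i j)%N.
Proof.
move=> olt uA uB sS; have [irr tr tot _] := olt.
have tr' : transitive (fun x y => lt y x) by move=> x y z /[swap]; apply: tr.
pose le x y := (x == y) || lt x y; pose ge x y := (x == y) || lt y x.
have letot : total le.
  by move=> x y; rewrite /le (eq_sym y); case: eqVneq => //= /tot.
have getot : total ge.
  by move=> x y; rewrite /ge (eq_sym y); case: eqVneq => //= /tot; rewrite orbC.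
have strict (r : rel G) (s : seq G) : transitive r -> uniq s ->
    sorted (fun x y => (x == y) || r x y) s -> sorted r s.
  move=> trr us; have trr' : transitive (fun x y => (x == y) || r x y).
    move=> y x z /predU1P[->//|xy] /predU1P[<-|yz]; first by rewrite xy orbT.
    by rewrite (trr _ _ _ xy yz) orbT.
  rewrite !sorted_pairwise //; elim: s us => //= x t IH /andP[xt ut] /andP[ax pt].
  rewrite IH // andbT; apply/allP => y yt; move: xt.
  by case/predU1P: (allP ax y yt) => // ->; rewrite yt.
have pA := permEl (perm_sort le A); have pB := permEl (perm_sort ge B).
rewrite -(perm_size pA) -(perm_size pB) -(perm_big _ pA) /=.
under eq_bigr do rewrite -(perm_big _ pB).
apply: (sorted_sumset_count olt) => //; apply: strict; rewrite ?sort_uniq //; exact: sort_sorted.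
Qed.

(** * Finitely supported measures *)

(* A list of pairs (point, weight) stands for a finitely supported measure; a
   point may be listed several times. *)
Definition expect (R : realFieldType) (T : Type) (l : seq (T * R)) (h : T -> R) : R :=
  \sum_(p <- l) p.2 * h p.1.

Definition wnonneg (R : realFieldType) (T : Type) (l : seq (T * R)) : bool :=
  all (fun p => 0 <= p.2) l.

Definition wconv (R : realFieldType) (G : zmodType) (l1 l2 : seq (G * R)) :
    seq (G * R) :=
  [seq (p.1 + q.1, p.2 * q.2) | p <- l1, q <- l2].

Definition wopp (R : realFieldType) (G : zmodType) (l : seq (G * R)) :
    seq (G * R) :=
  [seq (- p.1, p.2) | p <- l].

(** The law of the difference of two independent variables of law [l]. *)
Definition autocorr (R : realFieldType) (G : zmodType) (l : seq (G * R)) :=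
  wconv l (wopp l).

Lemma expect_conv (R : realFieldType) (G : zmodType) (l1 l2 : seq (G * R)) (h : G -> R) :
  expect (wconv l1 l2) h = expect l1 (fun x => expect l2 (fun y => h (x + y))).
Proof.
rewrite /expect big_allpairs_dep; apply: eq_bigr => p _.
by rewrite big_distrr; apply: eq_bigr => q _ /=; rewrite mulrA.
Qed.

Lemma expect_opp (R : realFieldType) (G : zmodType) (l : seq (G * R)) (h : G -> R) :
  expect (wopp l) h = expect l (fun x => h (- x)).
Proof. by rewrite /expect big_map. Qed.

Lemma eq_expect (R : realFieldType) (T : Type) (l : seq (T * R)) (h1 h2 : T -> R) :
  h1 =1 h2 -> expect l h1 = expect l h2.
Proof. by move=> e; apply: eq_bigr => p _; rewrite e. Qed.

Lemma expect_sum (R : realFieldType) (T : Type) (l : seq (T * R)) (I : Type)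
    (r : seq I) (F : I -> T -> R) :
  expect l (fun x => \sum_(i <- r) F i x) = \sum_(i <- r) expect l (F i).
Proof.
by rewrite /expect exchange_big; apply: eq_bigr => p _; rewrite big_distrr.
Qed.

Lemma expectD (R : realFieldType) (T : Type) (l : seq (T * R)) (h1 h2 : T -> R) :
  expect l (fun x => h1 x + h2 x) = expect l h1 + expect l h2.
Proof. by rewrite /expect -big_split; apply: eq_bigr => p _ /=; rewrite mulrDr. Qed.

Lemma exchange_expect (R : realFieldType) (T1 T2 : Type) (l1 : seq (T1 * R))
    (l2 : seq (T2 * R)) (h : T1 -> T2 -> R) :
  expect l1 (fun x => expect l2 (h x)) = expect l2 (fun y => expect l1 (h^~ y)).
Proof.
rewrite /expect.
under eq_bigr do rewrite big_distrr.
rewrite exchange_big; apply: eq_bigr => q _; rewrite big_distrr.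
by apply: eq_bigr => p _ /=; rewrite mulrCA.
Qed.

Lemma le_expect (R : realFieldType) (T : Type) (l : seq (T * R)) (h1 h2 : T -> R) :
  wnonneg l -> (forall x, h1 x <= h2 x) -> expect l h1 <= expect l h2.
Proof.
move=> + h12; rewrite /expect; elim: l => [|p l IH] /=; first by rewrite !big_nil.
by case/andP=> p0 /IH h; rewrite !big_cons lerD // ler_wpM2l.
Qed.

Lemma expect_ge0 (R : realFieldType) (T : Type) (l : seq (T * R)) (h : T -> R) :
  wnonneg l -> (forall x, 0 <= h x) -> 0 <= expect l h.
Proof.
move=> l0 h0; rewrite -(_ : expect l (fun=> 0) = 0); first exact: le_expect.
by rewrite /expect big1 // => p _ /=; rewrite mulr0.
Qed.

Lemma wnonneg_conv (R : realFieldType) (G : zmodType) (l1 l2 : seq (G * R)) :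
  wnonneg l1 -> wnonneg l2 -> wnonneg (wconv l1 l2).
Proof.
move=> l10 l20; apply/all_allpairsP => p q /(allP l10) p0 /(allP l20) q0.
exact: mulr_ge0.
Qed.

Lemma wnonneg_opp (R : realFieldType) (G : zmodType) (l : seq (G * R)) :
  wnonneg l -> wnonneg (wopp l).
Proof. by rewrite /wnonneg all_map. Qed.

Lemma wnonneg_autocorr (R : realFieldType) (G : zmodType) (l : seq (G * R)) :
  wnonneg l -> wnonneg (autocorr l).
Proof. by move=> l0; rewrite wnonneg_conv ?wnonneg_opp. Qed.

Lemma expect_points (R : realFieldType) (T : eqType) (l : seq (T * R)) (K : seq T)
    (h : T -> R) : uniq K -> {subset [seq p.1 | p <- l] <= K} ->
  expect l h = \sum_(x <- K) expect l (fun y => (y == x)%:R) * h x.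
Proof.
move=> uK lK; rewrite /expect.
under [RHS]eq_bigr do rewrite big_distrl.
rewrite exchange_big; apply: eq_big_seq => p pl.
rewrite (bigD1_seq p.1) ?lK ?map_f //= eqxx mulr1 big1 ?addr0 // => x xp.
by rewrite eq_sym (negbTE xp) mulr0 mul0r.
Qed.

Lemma natr_mem_sum (R : realFieldType) (T : eqType) (S : seq T) (y : T) : uniq S ->
  (y \in S)%:R = \sum_(x <- S) (y == x)%:R :> R.
Proof.
move=> uS; case: (boolP (y \in S)) => yS.
  rewrite (bigD1_seq y) //= eqxx big1 ?addr0 // => x xy.
  by rewrite eq_sym (negbTE xy).
rewrite big1_seq // => x /andP[_ xS]; case: eqP => // e; by rewrite e xS in yS.
Qed.

(** * Summation by parts and rearrangement *)

Lemma abel_le (R : realFieldType) (n : nat) (c u v : nat -> R) :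
  (forall i, c i.+1 <= c i) ->
  (forall m, (m <= n)%N -> \sum_(i < m) u i <= \sum_(i < m) v i) ->
  (forall i, 0 <= c i) ->
  \sum_(i < n) u i * c i <= \sum_(i < n) v i * c i.
Proof.
move=> cdec uv c0; pose W m := \sum_(i < m) v i - \sum_(i < m) u i.
have W0 m : (m <= n)%N -> 0 <= W m by move=> mn; rewrite subr_ge0 uv.
(* The boundary term [W m * c m] is kept because the induction feeds on it; nonnegativity discards
   it at the end. *)
have key m : (m <= n)%N ->
    W m * c m <= \sum_(i < m) v i * c i - \sum_(i < m) u i * c i.
  elim: m => [|m IH] mn; first by rewrite /W !big_ord0; lra.
  have := IH (ltnW mn); have := ler_wpM2l (W0 _ mn) (cdec m).
  rewrite /W !big_ord_recr /=; lra.
by rewrite -subr_ge0; apply: le_trans (key n _) => //; rewrite mulr_ge0 ?W0.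
Qed.

(** Weak majorization: the decreasing rearrangement of the point masses of [l] has partial sums at
    most those of [phi]. *)
Definition dominated (R : realFieldType) (T : eqType) (l : seq (T * R)) (phi : nat -> R) :=
  forall S : seq T, uniq S -> expect l (fun x => (x \in S)%:R) <= \sum_(i < size S) phi i.

(** With the support listed by decreasing [h], two summations by parts suffice: the first replaces
    the masses by [phi] against the decreasing weights [h], the second replaces [h] by [eta] against
    the decreasing weights [phi]. *)
Lemma expect_rearrange (R : realFieldType) (T : eqType) (l : seq (T * R)) (h : T -> R)
    (phi eta : nat -> R) (N : nat) :
  wnonneg l -> (forall x, 0 <= h x) ->
  (forall i, phi i.+1 <= phi i) -> (forall i, 0 <= phi i) -> (forall i, 0 <= eta i) ->
  dominated l phi ->
  (forall S, uniq S -> \sum_(x <- S) h x <= \sum_(i < size S) eta i) ->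
  (size l <= N)%N ->
  expect l h <= \sum_(i < N) phi i * eta i.
Proof.
move=> l0 h0 phidec phi0 eta0 lphi heta.
case: l l0 lphi => [|[x0 w0] l'] l0 lphi lN.
  by rewrite /expect big_nil sumr_ge0 // => i _; rewrite mulr_ge0.
set l := (_ :: l') in l0 lphi lN *.
pose K := sort (fun x y => h y <= h x) (undup [seq p.1 | p <- l]).
have uK : uniq K by rewrite sort_uniq undup_uniq.
have KN : (size K <= N)%N.
  by rewrite size_sort (leq_trans (size_undup _)) // size_map.
(* Padding by 0 beyond the support keeps [hK] nonincreasing at every index, as [abel_le] demands. *)
pose hK i := if (i < size K)%N then h (nth x0 K i) else 0.
have htr : transitive (fun x y => h y <= h x) by move=> y x z /[swap]; apply: le_trans.
have hKdec i : hK i.+1 <= hK i.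
  rewrite /hK; case: ltnP => iK; last by case: ifP.
  rewrite (ltnW iK); apply: (sorted_leq_nth htr) => //.
  - by apply: sort_sorted => x y; apply: le_total.
  - by rewrite inE ltnW.
have hK0 i : 0 <= hK i by rewrite /hK; case: ifP.
have partial (F : T -> R) m : (m <= size K)%N ->
    \sum_(i < m) F (nth x0 K i) = \sum_(x <- take m K) F x.
  move=> mK; rewrite (big_nth x0) size_takel // big_mkord.
  by apply: eq_bigr => i _; rewrite nth_take.
rewrite (@expect_points _ _ _ K) //; last first.
  by move=> x; rewrite mem_sort mem_undup.
rewrite (big_nth x0) big_mkord.
apply: (@le_trans _ _ (\sum_(i < size K) phi i * hK i)).
  pose mass i := expect l (fun y => (y == nth x0 K i)%:R).
  rewrite (eq_bigr (fun i : 'I_(size K) => mass i * hK i)); last first.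
    by move=> i _; rewrite /hK ltn_ord.
  apply: (@abel_le _ _ hK mass phi) => // m mK.
  rewrite (partial (fun x => expect l (fun y => (y == x)%:R))) // -expect_sum.
  have := lphi _ (take_uniq m uK); rewrite size_takel //; apply: le_trans.
  rewrite le_eqVlt; apply/orP; left.
  by apply/eqP/eq_expect => y; rewrite natr_mem_sum ?take_uniq.
apply: (@le_trans _ _ (\sum_(i < size K) eta i * phi i)).
  under eq_bigr do rewrite mulrC.
  apply: (@abel_le _ _ phi hK) => // m mK.
  under eq_bigr => i _ do rewrite /hK (leq_trans (ltn_ord i) mK).
  by rewrite partial //; have := heta _ (take_uniq m uK); rewrite size_takel.
under eq_bigr do rewrite mulrC.
rewrite -!(big_mkord xpredT (fun i => phi i * eta i)) (big_cat_nat (n := size K) (p := N)) //=.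
by rewrite lerDl sumr_ge0 // => i _; rewrite mulr_ge0.
Qed.

(** A discrete Riesz rearrangement inequality. Using [expect_rearrange] in each variable in turn
    reduces it to indicators of finite sets [A] and [B], where it becomes [sumset_count]. *)
Lemma expect_conv_le_zigzag (R : realFieldType) (G : zmodType) (lt : rel G)
    (l1 l2 : seq (G * R)) (phi1 phi2 : nat -> R) (S : seq G) (k N : nat) :
  group_order lt -> wnonneg l1 -> wnonneg l2 ->
  (forall i, phi1 i.+1 <= phi1 i) -> (forall i, 0 <= phi1 i) -> dominated l1 phi1 ->
  (forall i, phi2 i.+1 <= phi2 i) -> (forall i, 0 <= phi2 i) -> dominated l2 phi2 ->
  (size S <= k.*2.+1)%N -> (size l1 <= N)%N -> (size l2 <= N)%N ->
  expect (wconv l1 l2) (fun x => (x \in S)%:R)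
  <= \sum_(i < N) phi1 i * \sum_(j < N) phi2 j * (zigzag_near k i j)%:R.
Proof.
move=> olt l10 l20 dec1 ge1 dom1 dec2 ge2 dom2 Sk N1 N2.
rewrite expect_conv.
have ind0 (b : bool) : 0 <= b%:R :> R by rewrite ler0n.
pose eta i : R := \sum_(j < N) phi2 j * (zigzag_near k i j)%:R.
apply: (@expect_rearrange _ _ l1 _ phi1 eta) => //.
- by move=> x; apply: expect_ge0.
- by move=> i; apply: sumr_ge0 => j _; apply: mulr_ge0.
move=> A uA; rewrite -expect_sum.
have -> : \sum_(i < size A) eta i =
    \sum_(j < N) phi2 j * \sum_(i < size A) (zigzag_near k i j)%:R.
  by rewrite exchange_big; apply: eq_bigr => j _; rewrite big_distrr.
pose etaA j : R := \sum_(i < size A) (zigzag_near k i j)%:R.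
apply: (@expect_rearrange _ _ l2 _ phi2 etaA) => //.
- by move=> y; apply: sumr_ge0 => x _.
- by move=> j; apply: sumr_ge0 => i _.
move=> B uB; rewrite exchange_big /etaA [leRHS]exchange_big /=.
under eq_bigr do rewrite -natr_sum.
under [leRHS]eq_bigr do rewrite -natr_sum.
by rewrite -!natr_sum ler_nat; apply: (sumset_count olt).
Qed.

(** * The zigzag bijection and masses of finite sets *)

Lemma zigzag_inj : injective zigzag.
Proof.
move=> i j; rewrite /zigzag /= !uphalf_half.
have := odd_double_half i; have := odd_double_half j.
by case: (odd i) => /=; case: (odd j) => /= *; lia.
Qed.

Lemma zigzag_surj (z : int) : exists i, zigzag i = z.
Proof.
case: z => n; last by exists n.+1.*2; rewrite /zigzag odd_double doubleK; lia.
case: n => [|n]; first by exists 0%N.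
by exists n.*2.+1; rewrite /zigzag /= odd_double /= doubleK.
Qed.

Lemma mem_zigzag_ball (m : nat) (y : int) :
  (y \in [seq zigzag i | i <- iota 0 m.*2.+1]) = (`|y| <= m%:Z).
Proof.
have [i <-] := zigzag_surj y; rewrite (mem_map zigzag_inj) mem_iota add0n.
rewrite /zigzag /= uphalf_half; have := odd_double_half i.
by case: (odd i) => /= *; lia.
Qed.

Lemma sum_iota (V : nmodType) (n : nat) (F : nat -> V) :
  \sum_(i <- iota 0 n) F i = \sum_(i < n) F i.
Proof. by rewrite -(big_mkord xpredT F) /index_iota subn0. Qed.

Lemma expect_mem (R : realFieldType) (T : eqType) (l : seq (T * R)) (S : seq T) :
  uniq S -> expect l (fun x => (x \in S)%:R) = \sum_(x <- S) expect l (fun y => (y == x)%:R).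
Proof.
by move=> uS; rewrite -expect_sum; apply: eq_expect => y; rewrite natr_mem_sum.
Qed.

(** * Autocorrelation and symmetrization *)

Lemma expect_autocorr (R : realFieldType) (G : zmodType) (l : seq (G * R)) (h : G -> R) :
  expect (autocorr l) h = expect l (fun x => expect l (fun y => h (x - y))).
Proof. by rewrite expect_conv; apply: eq_expect => x; rewrite expect_opp. Qed.

Lemma expect_autocorr_sym (R : realFieldType) (G : zmodType) (l : seq (G * R)) (h : G -> R) :
  expect (autocorr l) (fun x => h (- x)) = expect (autocorr l) h.
Proof.
rewrite !expect_autocorr exchange_expect; apply: eq_expect => y.
by apply: eq_expect => x; rewrite opprB.
Qed.

Lemma expect_autocorr_conv (R : realFieldType) (G : zmodType) (l1 l2 : seq (G * R))
    (h : G -> R) :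
  expect (autocorr (wconv l1 l2)) h = expect (wconv (autocorr l1) (autocorr l2)) h.
Proof.
rewrite expect_autocorr !expect_conv; apply: eq_expect => x; rewrite expect_opp.
under [RHS]eq_expect => x'. rewrite expect_conv. over.
rewrite [RHS]exchange_expect; apply: eq_expect => y.
rewrite expect_conv; apply: eq_expect => x'.
rewrite expect_opp; apply: eq_expect => y'.
by congr h; rewrite opprD addrACA.
Qed.

(** The left side is the sum over [x] of [m a x * m b (t - x)], hence at most half the sum of the
    two squares; the sum of all [m l x ^+ 2] is the probability that two independent copies
    coincide. *)
Lemma expect_conv_eq_le (R : realFieldType) (G : zmodType) (a b : seq (G * R)) (t : G) :
  expect (wconv a b) (fun x => (x == t)%:R)
  <= (expect (autocorr a) (fun x => (x == 0)%:R)
      + expect (autocorr b) (fun x => (x == 0)%:R)) / 2%:R.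
Proof.
pose m (l : seq (G * R)) x := expect l (fun y => (y == x)%:R).
have ac0 (l : seq (G * R)) K : uniq K -> {subset [seq p.1 | p <- l] <= K} ->
    expect (autocorr l) (fun x => (x == 0)%:R) = \sum_(x <- K) m l x ^+ 2.
  move=> uK lK; rewrite expect_autocorr (expect_points _ uK lK); apply: eq_bigr => x _.
  rewrite expr2; congr (_ * _); apply: eq_expect => y.
  by rewrite subr_eq0 eq_sym.
(* [K] covers the support of [a], and its image under [x -> t - x] covers that of [b], so all three
   sums can be indexed by [K]. *)
pose K := undup ([seq p.1 | p <- a] ++ [seq t - p.1 | p <- b]).
have uK : uniq K by rewrite undup_uniq.
have aK : {subset [seq p.1 | p <- a] <= K}.
  by move=> x xa; rewrite mem_undup mem_cat xa.
have inj : injective (fun x => t - x) by move=> x y /addrI/oppr_inj.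
rewrite (ac0 a K) // (ac0 b [seq t - x | x <- K]) ?map_inj_uniq //; last first.
  move=> _ /mapP[p pb ->]; apply/mapP; exists (t - p.1); last by rewrite subKr.
  by rewrite mem_undup mem_cat; apply/orP; right; apply/mapP; exists p.
rewrite expect_conv (expect_points _ uK aK) big_map -big_split /= big_distrl /=.
apply: ler_sum => x _.
have -> : expect b (fun y => (x + y == t)%:R) = m b (t - x).
  by apply: eq_expect => y; rewrite [y == _]eq_sym subr_eq addrC eq_sym.
rewrite -/(m a x); set u := m a x; set v := m b (t - x).
have := sqr_ge0 (u - v); lra.
Qed.

(** The previous bound with [b := wopp l], for which both coincidence terms agree. *)
Lemma autocorr_peak (R : realFieldType) (G : zmodType) (l : seq (G * R)) (t : G) :
  expect (autocorr l) (fun x => (x == t)%:R) <= expect (autocorr l) (fun x => (x == 0)%:R).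
Proof.
apply: le_trans (expect_conv_eq_le _ _ _) _.
have -> : expect (autocorr (wopp l)) (fun x => (x == 0)%:R)
          = expect (autocorr l) (fun x => (x == 0)%:R); last by lra.
rewrite !expect_autocorr expect_opp; apply: eq_expect => x; rewrite expect_opp.
by apply: eq_expect => y; rewrite -opprD oppr_eq0 subr_eq0 eq_sym.
Qed.

(** * Concentration of symmetrized laws *)

(** The comparison carried through the induction on the number of summands. Taken with [l := u], it
    says that the intervals around 0 are the heaviest sets of their size for [autocorr u]. *)
Definition concentrated (R : realFieldType) (G : zmodType)
    (l : seq (G * R)) (u : seq (int * R)) :=
  forall (S : seq G) (k : nat), (size S <= k.*2.+1)%N ->
  expect (autocorr l) (fun x => (x \in S)%:R)
  <= expect (autocorr u) (fun y => (`|y| <= k%:Z)%R%:R).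

(** Under [concentrated u u] this sequence is nonincreasing, so it is the decreasing rearrangement
    of the masses of [autocorr u]. *)
Definition zigzag_mass (R : realFieldType) (u : seq (int * R)) (i : nat) : R :=
  expect (autocorr u) (fun y => (y == zigzag i)%:R).

Lemma expect_ball (R : realFieldType) (u : seq (int * R)) (k : nat) :
  expect (autocorr u) (fun y => (`|y| <= k%:Z)%R%:R)
  = \sum_(i < k.*2.+1) zigzag_mass u i.
Proof.
under eq_expect => y do rewrite -mem_zigzag_ball.
by rewrite expect_mem ?(map_inj_uniq zigzag_inj) ?iota_uniq // big_map sum_iota.
Qed.

Lemma zigzag_mass_sym (R : realFieldType) (u : seq (int * R)) (m : nat) :
  zigzag_mass u m.*2.+2 = zigzag_mass u m.*2.+1.
Proof.
rewrite /zigzag_mass -expect_autocorr_sym; apply: eq_expect => y.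
congr (_%:R); rewrite eqr_oppLR; congr (_ == _).
by rewrite /zigzag /= odd_double /= doubleK; lia.
Qed.

Lemma zigzag_mass_dec (R : realFieldType) (u : seq (int * R)) :
  concentrated u u -> forall i, zigzag_mass u i.+1 <= zigzag_mass u i.
Proof.
move=> cu i; have := odd_double_half i; case: (odd i) => /= <-.
  by rewrite add1n zigzag_mass_sym.
rewrite add0n; set m := i./2.
(* The interval from [-m] to [m] with its point [zigzag m.*2 = - m] exchanged for [m + 1]. Comparing
   it with the interval leaves only the masses of these two points. *)
pose S := [seq zigzag j | j <- rcons (iota 0 m.*2) m.*2.+1].
have := cu S m; rewrite size_map size_rcons size_iota => /(_ (leqnn _)).
rewrite expect_mem; last first.
  rewrite map_inj_uniq ?rcons_uniq ?iota_uniq ?mem_iota; last exact: zigzag_inj.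
  by rewrite andbT; lia.
rewrite expect_ball big_map big_rcons /= big_ord_recr /=.
by rewrite sum_iota -!/(zigzag_mass u _) lerD2l.
Qed.

Lemma zigzag_mass_ge0 (R : realFieldType) (u : seq (int * R)) (i : nat) :
  wnonneg u -> 0 <= zigzag_mass u i.
Proof.
by move=> u0; apply: expect_ge0 => [|x]; rewrite ?wnonneg_autocorr ?ler0n.
Qed.

(** Partial sums of a nonincreasing sequence are concave, and [2s + 1] and [2t + 1] average to
    [2k + 2]. The induction moves [s] and [t] towards each other; at [s = k], [t = k + 1] the
    symmetry of the masses gives equality. *)
Lemma sum_zigzag_mass_concave (R : realFieldType) (u : seq (int * R)) (s t k : nat) :
  concentrated u u -> (s <= k)%N -> (s + t = k.*2.+1)%N ->
  \sum_(i < s.*2.+1) zigzag_mass u i + \sum_(i < t.*2.+1) zigzag_mass u i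
  <= 2%:R * \sum_(i < k.*2.+2) zigzag_mass u i.
Proof.
move=> cu; move e : (k - s)%N => j; elim: j s t e => [|j IH] s t e sk st.
  have -> : s = k by lia.
  have -> : t = k.+1 by lia.
  by rewrite doubleS !big_ord_recr /= zigzag_mass_sym; lra.
have -> : t = t.-1.+1 by lia.
apply: le_trans (IH s.+1 t.-1 _ _ _); try lia.
have dec : zigzag_mass u t.-1.*2.+1 <= zigzag_mass u s.*2.+1.
  have -> : t.-1.*2.+1 = (s.*2.+1 + (t.-1 - s).*2)%N by lia.
  elim: ((t.-1 - s).*2)%N => [|i IHi]; first by rewrite addn0.
  by rewrite addnS (le_trans (zigzag_mass_dec cu _)).
by rewrite !doubleS !big_ord_recr /= !zigzag_mass_sym; lra.
Qed.

(** In an ordered group only 0 is its own opposite, so [I] consists of 0, its positive elements and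
    their opposites. *)
Lemma symmetric_size_odd (G : zmodType) (lt : rel G) (I : seq G) :
  group_order lt -> uniq I -> 0 \in I -> (forall x, x \in I -> - x \in I) ->
  odd (size I).
Proof.
move=> [irr tr tot add] uI I0 symI.
have opp x : lt 0 (- x) = lt x 0.
  apply/idP/idP => h; first by have := add x _ _ h; rewrite add0r addNr.
  by have := add (- x) _ _ h; rewrite add0r addrN.
have e : perm_eq I (0 :: [seq x <- I | lt 0 x] ++ [seq - x | x <- I & lt 0 x]).
  apply: uniq_perm => //.
    rewrite cons_uniq cat_uniq filter_uniq // (map_inj_uniq oppr_inj) ?filter_uniq //.
    rewrite mem_cat mem_filter irr /= andbT; apply/andP; split.
      by apply/mapP => -[x]; rewrite mem_filter => /andP[x0 _] /eqP;
        rewrite eq_sym oppr_eq0 => /eqP x00; rewrite x00 irr in x0.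
    apply/hasPn => _ /mapP[x + ->]; rewrite !mem_filter opp => /andP[x0 _].
    by apply/negP => /andP[x0' _]; have := tr _ _ _ x0 x0'; rewrite irr.
  move=> x; rewrite inE mem_cat mem_filter.
  have -> : (x \in [seq - x | x <- I & lt 0 x]) = lt x 0 && (x \in I).
    apply/mapP/andP => [[y + ->]|[x0 xI]].
      by rewrite mem_filter -opp opprK => /andP[-> /symI ->].
    by exists (- x); rewrite ?opprK // mem_filter opp x0 symI.
  case: eqP => [->//|/eqP /tot /orP[]] -> /=; by case: (x \in I); rewrite ?andbF ?andbT ?orbT.
by rewrite (perm_size e) /= size_cat size_map addnn odd_double.
Qed.

(* On 2k+1 points this is the hypothesis. A set S of 2k points containing 0 is
   averaged with -S: both the union and the intersection of S and -S have an odd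
   number of points. *)
Lemma concentrated_dominated (R : realFieldType) (G : zmodType) (lt : rel G)
    (l : seq (G * R)) (u : seq (int * R)) :
  group_order lt -> wnonneg l -> wnonneg u -> concentrated l u -> concentrated u u ->
  dominated (autocorr l) (zigzag_mass u).
Proof.
move=> olt l0 u0 lu cu S uS.
have := odd_double_half (size S); case: (odd (size S)) => /= eS.
  by rewrite -eS add1n -expect_ball lu // -{1}eS add1n.
case: S uS eS => [|x S'] uS.
  by rewrite big_ord0 /expect big1 // => p _; rewrite mulr0.
case k1: (size (x :: S'))./2 => [|k]; rewrite -?k1; first by rewrite k1 /=.
move=> eS; rewrite -eS k1; rewrite k1 in eS.
(* The peak of the autocorrelation is at 0, so 0 may be assumed to be in S. *)
have [S [uS2 S0 sS leS]] : exists S : seq G, [/\ uniq S, 0 \in S, size S = (size S').+1 &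
    expect (autocorr l) (fun y => (y \in x :: S')%:R)
    <= expect (autocorr l) (fun y => (y \in S)%:R)].
  case: (boolP (0 \in x :: S')) => h0; first by exists (x :: S').
  move: (h0); rewrite inE negb_or => /andP[_ h0'].
  have uS0 : uniq (0 :: S') by move: uS => /= /andP[_ ->]; rewrite h0'.
  exists (0 :: S'); split => //; first by rewrite mem_head.
  by rewrite !expect_mem // !big_cons lerD2r autocorr_peak.
apply: le_trans leS _.
pose I : seq G := [seq y <- S | - y \in S].
pose T : seq G := S ++ [seq - y | y <- S & - y \notin S].
have Iodd : odd (size I).
  apply: (symmetric_size_odd olt); first by rewrite filter_uniq.
    by rewrite mem_filter oppr0 S0.
  by move=> y; rewrite !mem_filter opprK andbC.
have sIT : (size I + size T = (size S).*2)%N.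
  rewrite size_cat size_map !size_filter addnCA -addnn; congr addn.
  by rewrite -(count_predC (fun y => - y \in S) S).
have split2 : 2%:R * expect (autocorr l) (fun y => (y \in S)%:R)
    = expect (autocorr l) (fun y => (y \in I)%:R) + expect (autocorr l) (fun y => (y \in T)%:R).
  rewrite mulr_natl mulr2n -{2}expect_autocorr_sym -!expectD; apply: eq_expect => y.
  rewrite mem_filter mem_cat.
  have -> : (y \in [seq - y | y <- S & - y \notin S]) = (- y \in S) && (y \notin S).
    apply/mapP/andP => [[z + ->]|[yS ynS]]; first by rewrite mem_filter opprK => /andP[-> ->].
    by exists (- y); rewrite ?opprK // mem_filter opprK ynS yS.
  by case: (y \in S); case: (- y \in S); rewrite /= ?addr0 ?add0r.
have sI := odd_double_half (size I); rewrite Iodd /= in sI.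
set s := (size I)./2 in sI.
have sS2 : size S = k.*2.+2 by rewrite sS -[RHS]/(0 + k.+1.*2)%N eS.
have sk : (s <= k)%N.
  have : (1 + s.*2 <= k.*2.+2)%N by rewrite sI -sS2 size_filter count_size.
  lia.
rewrite sS2 -sI in sIT.
have sT : size T = ((k.*2.+1 - s).*2.+1)%N by move: sIT; set n := size T; lia.
have := lu I s; rewrite -{1}sI leqnn => /(_ isT).
have := lu T (k.*2.+1 - s)%N; rewrite sT leqnn => /(_ isT).
rewrite !expect_ball => hT hI.
(* The sizes of [I] and [T] average to the size [2k + 2] of [S], so concavity bounds their two
   partial sums by twice the one for [S]. *)
have := sum_zigzag_mass_concave cu sk (_ : s + (k.*2.+1 - s) = k.*2.+1)%N.
move=> /(_ ltac:(lia)).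
rewrite doubleS add0n; lra.
Qed.

Lemma zigzag_cover (s : seq int) :
  exists N, forall M, (N <= M)%N -> {subset s <= [seq zigzag i | i <- iota 0 M]}.
Proof.
elim: s => [|z s [N IH]]; first by exists 0%N.
have [i iz] := zigzag_surj z; exists (maxn N i.+1) => M; rewrite geq_max => /andP[NM iM].
move=> y; rewrite inE => /predU1P[->|]; last exact: IH.
by rewrite -iz map_f // mem_iota.
Qed.

(** A threshold instead of a fixed length, so that two laws can be expanded up to a common index. *)
Lemma expect_zigzag (R : realFieldType) (u : seq (int * R)) :
  exists N, forall M h, (N <= M)%N ->
  expect (autocorr u) h = \sum_(i < M) zigzag_mass u i * h (zigzag i).
Proof.
have [N NP] := zigzag_cover [seq p.1 | p <- autocorr u]; exists N => M h NM.
by rewrite (expect_points _ _ (NP _ NM)) ?(map_inj_uniq zigzag_inj) ?iota_uniq // big_map sum_iota.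
Qed.

(** The induction step: the autocorrelation of a convolution is the convolution of the
    autocorrelations, so the rearrangement inequality applies with the two [zigzag_mass] sequences.
    The resulting bound is exactly the value for [wconv u1 u2]. *)
Lemma concentrated_conv (R : realFieldType) (G : zmodType) (lt : rel G)
    (l1 l2 : seq (G * R)) (u1 u2 : seq (int * R)) :
  group_order lt -> wnonneg l1 -> wnonneg l2 -> wnonneg u1 -> wnonneg u2 ->
  concentrated l1 u1 -> concentrated l2 u2 -> concentrated u1 u1 -> concentrated u2 u2 ->
  concentrated (wconv l1 l2) (wconv u1 u2).
Proof.
move=> olt l10 l20 u10 u20 lu1 lu2 cu1 cu2 S k Sk.
rewrite !expect_autocorr_conv.
have [N1 E1] := expect_zigzag u1; have [N2 E2] := expect_zigzag u2.
pose M := maxn (maxn N1 N2) (maxn (size (autocorr l1)) (size (autocorr l2))).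
have dom1 := concentrated_dominated olt l10 u10 lu1 cu1.
have dom2 := concentrated_dominated olt l20 u20 lu2 cu2.
apply: le_trans (expect_conv_le_zigzag (N := M) olt _ _ _ _ dom1 _ _ dom2 Sk _ _) _;
  rewrite ?wnonneg_autocorr //;
  try (by [apply: zigzag_mass_dec | move=> i; apply: zigzag_mass_ge0 | lia]).
rewrite expect_conv (E1 M); last by lia.
rewrite le_eqVlt; apply/orP; left; apply/eqP; apply: eq_bigr => i _; congr (_ * _).
(* Symmetry of [autocorr u2] turns the sum of the two points into the difference that appears in
   [zigzag_near]. *)
rewrite -[RHS]expect_autocorr_sym (E2 M) //; by lia.
Qed.

(** * The extremal law and the case of one summand *)

Lemma int_group_order : group_order (<%R : rel int).
Proof.
split => [x|y x z|x y|z x y]; rewrite ?ltxx ?ltrD2r //; first exact: lt_trans.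
by move/lt_total.
Qed.

(** The law of [U] when [N] is the floor of [alpha^-1]. The lemmas retain only the consequence
    [0 <= 1 - alpha * N%:R <= alpha] of that choice. *)
Definition wunif (R : realFieldType) (alpha : R) (N : nat) : seq (int * R) :=
  rcons [seq (i%:Z, alpha) | i <- iota 0 N] (N%:Z, 1 - alpha * N%:R).

Lemma expect_wunif (R : realFieldType) (alpha : R) (N : nat) (h : int -> R) :
  expect (wunif alpha N) h
  = alpha * (\sum_(i < N) h i%:Z) + (1 - alpha * N%:R) * h N%:Z.
Proof.
rewrite /expect /wunif big_rcons /= big_map /= sum_iota -big_distrr /=.
by rewrite addrC.
Qed.

(** The masses of [wunif] as a sequence continued by 0, the form required by [dominated]. *)
Definition unif_weight (R : realFieldType) (alpha : R) (N i : nat) : R :=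
  if (i < N)%N then alpha else if i == N then 1 - alpha * N%:R else 0.

Lemma sum_unif_weight (R : realFieldType) (alpha : R) (N M : nat) (F : nat -> R) :
  (N < M)%N -> \sum_(i < M) unif_weight alpha N i * F i
  = alpha * (\sum_(i < N) F i) + (1 - alpha * N%:R) * F N.
Proof.
move=> NM; rewrite -(big_mkord xpredT (fun i => unif_weight alpha N i * F i)).
rewrite (big_cat_nat (n := N.+1)) //= [X in _ + X]big1_seq ?addr0; last first.
  move=> i; rewrite mem_index_iota /= => /andP[Ni _]; rewrite /unif_weight ltnNge (ltnW Ni) /= gtn_eqF ?mul0r //.
rewrite big_nat_recr //= big_mkord big_distrr /= {2}/unif_weight ltnn eqxx.
by congr (_ + _); apply: eq_bigr => i _; rewrite /unif_weight ltn_ord.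
Qed.

Lemma unif_weight_dec (R : realFieldType) (alpha : R) (N i : nat) :
  0 <= 1 - alpha * N%:R <= alpha -> unif_weight alpha N i.+1 <= unif_weight alpha N i.
Proof.
move=> h; rewrite /unif_weight; case: (ltngtP i.+1 N) => iN.
- by rewrite lexx.
- by case: eqP => _; lra.
- by lra.
Qed.

Lemma unif_weight_ge0 (R : realFieldType) (alpha : R) (N i : nat) :
  0 <= 1 - alpha * N%:R <= alpha -> 0 <= unif_weight alpha N i.
Proof. by move=> h; rewrite /unif_weight; case: ifP => _; [|case: ifP => _]; lra. Qed.

(** A set of [m] points has mass at most [m * alpha] and at most 1. The first bound is the partial
    sum for [m <= N]; beyond [N] the partial sums equal 1. *)
Lemma unif_weight_dominated (R : realFieldType) (T : eqType) (l : seq (T * R))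
    (alpha : R) (N : nat) :
  wnonneg l -> (forall x, expect l (fun y => (y == x)%:R) <= alpha) ->
  expect l (fun=> 1) <= 1 -> dominated l (unif_weight alpha N).
Proof.
move=> l0 la l1 S uS; case: (leqP (size S) N) => SN.
  under eq_bigr => i _ do rewrite /unif_weight (leq_trans (ltn_ord i) SN).
  rewrite sumr_const card_ord expect_mem //.
  rewrite -[leRHS]addr0 -iter_addr -count_predT -big_const_seq.
  by apply: ler_sum => x _.
have := @sum_unif_weight _ alpha N _ (fun=> 1) SN.
under eq_bigr do rewrite mulr1.
move=> ->; rewrite sumr_const card_ord.
apply: (@le_trans _ _ (expect l (fun=> 1))).
  by apply: le_expect => // x; rewrite lern1 leq_b1.
lra.
Qed.

(** [zigzag N] is an endpoint of the interval formed by the first [N + 1] zigzag values, as [N] is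
    of 0, ..., [N]. Both counts are [minn k N]; the left one comes from the hook with [p = q = N],
    whose arms are equal. *)
Lemma sum_zigzag_near_last (k N : nat) :
  (\sum_(i < N) zigzag_near k i N = \sum_(i < N) (`|i%:Z - N%:Z| <= k%:Z)%R)%N.
Proof.
have -> : (\sum_(i < N) (`|i%:Z - N%:Z| <= k%:Z)%R = minn k N)%N.
  elim: N => [|N IH]; first by rewrite big_ord0 minn0.
  rewrite big_ord_recl /=.
  under eq_bigr => i _ do
    rewrite /bump /= add1n -[i.+1]addn1 -[N.+1]addn1 !PoszD opprD addrACA subrr addr0.
  by rewrite IH; lia.
have := zigzag_hook k N N; rewrite big_ord_recr /=.
have -> : zigzag_near k N N by rewrite /zigzag_near subrr normr0.
have -> : (\sum_(j < N) zigzag_near k N j = \sum_(j < N) zigzag_near k j N)%N.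
  by apply: eq_bigr => j _; rewrite /zigzag_near distrC.
set s := (\sum_(i < N) _)%N; rewrite addn1; lia.
Qed.

Lemma sum_zigzag_near (k N : nat) :
  (\sum_(i < N) \sum_(j < N) zigzag_near k i j
   = \sum_(i < N) \sum_(j < N) (`|i%:Z - j%:Z| <= k%:Z)%R)%N.
Proof.
elim: N => [|N IH]; first by rewrite !big_ord0.
rewrite !big_ord_recr /=.
under eq_bigr do rewrite big_ord_recr /=.
under [X in _ = (X + _)%N]eq_bigr do rewrite big_ord_recr /=.
rewrite !big_split /= IH -sum_zigzag_near_last.
have sym (f : nat -> nat -> bool) : (forall i j, f i j = f j i) ->
    (\sum_(j < N) f N j = \sum_(j < N) f j N)%N.
  by move=> h; apply: eq_bigr => j _; rewrite h.
rewrite (sym (zigzag_near k)) => [|i j]; last by rewrite /zigzag_near distrC.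
rewrite (sym (fun i j => `|i%:Z - j%:Z| <= k%:Z)%R) => [|i j]; last by rewrite distrC.
by rewrite -sum_zigzag_near_last /zigzag_near !subrr.
Qed.

(** Both [l] and its reflection are dominated by [unif_weight], so rearrangement bounds the left
    side by the value for these weights placed on the first [N + 1] zigzag points. The two preceding
    counts show that placing them on 0, ..., [N] gives the same value. *)
Lemma unif_concentrated (R : realFieldType) (G : zmodType) (lt : rel G)
    (l : seq (G * R)) (alpha : R) (N : nat) :
  group_order lt -> 0 <= 1 - alpha * N%:R <= alpha ->
  wnonneg l -> (forall x, expect l (fun y => (y == x)%:R) <= alpha) ->
  expect l (fun=> 1) <= 1 -> concentrated l (wunif alpha N).
Proof.
move=> olt aN l0 la l1 S k Sk.
have dom := unif_weight_dominated N l0 la l1.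
have dec i := unif_weight_dec i aN; have ge0 i := unif_weight_ge0 i aN.
have domo : dominated (wopp l) (unif_weight alpha N).
  apply: unif_weight_dominated; rewrite ?wnonneg_opp ?expect_opp // => x.
  by rewrite expect_opp -(opprK x); under eq_expect do rewrite eqr_opp.
pose M := maxn N.+1 (size l); have NM : (N < M)%N by rewrite leq_maxl.
apply: le_trans (expect_conv_le_zigzag (N := M) olt _ _ dec ge0 dom dec ge0 domo Sk _ _) _;
  rewrite ?wnonneg_opp ?size_map ?leq_maxr //.
(* Both sides are expanded into a square of [N] by [N] terms, two border sums and a corner, which
   are then matched separately. *)
have inner i := sum_unif_weight alpha (fun j => (zigzag_near k i j)%:R) NM.
under eq_bigr do rewrite inner.
rewrite (sum_unif_weight alpha (fun i => alpha * (\sum_(j < N) (zigzag_near k i j)%:R)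
  + (1 - alpha * N%:R) * (zigzag_near k i N)%:R) NM).
rewrite expect_autocorr expect_wunif expect_wunif.
under [X in _ <= _ * X + _]eq_bigr do rewrite expect_wunif.
rewrite !big_split /= -!big_distrr /=.
have sum2 : \sum_(i < N) \sum_(j < N) (zigzag_near k i j)%:R
    = \sum_(i < N) \sum_(j < N) (`|i%:Z - j%:Z| <= k%:Z)%R%:R :> R.
  under eq_bigr do rewrite -natr_sum.
  under [RHS]eq_bigr do rewrite -natr_sum.
  by rewrite -!natr_sum sum_zigzag_near.
have sum1 : \sum_(i < N) (zigzag_near k i N)%:R
    = \sum_(i < N) (`|i%:Z - N%:Z| <= k%:Z)%R%:R :> R.
  by rewrite -!natr_sum sum_zigzag_near_last.
rewrite sum2 sum1 le_eqVlt; apply/orP; left; apply/eqP.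
congr (_ + _ * (_ * _ + _)).
  rewrite (eq_bigr (fun i : 'I_N => (zigzag_near k i N)%:R)) ?sum1.
    by apply: eq_bigr => i _; rewrite distrC.
  by move=> i _; rewrite /zigzag_near distrC.
by rewrite /zigzag_near !subrr.
Qed.

Lemma wnonneg_wunif (R : realFieldType) (alpha : R) (N : nat) :
  0 <= 1 - alpha * N%:R <= alpha -> wnonneg (wunif alpha N).
Proof.
move=> h; rewrite /wnonneg all_rcons all_map /=; apply/andP; split; first by lra.
by apply/allP => i _ /=; lra.
Qed.

Lemma wunif_self_concentrated (R : realFieldType) (alpha : R) (N : nat) :
  0 <= 1 - alpha * N%:R <= alpha -> concentrated (wunif alpha N) (wunif alpha N).
Proof.
move=> aN; apply: (@unif_concentrated _ _ <%R) => //.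
- exact: int_group_order.
- exact: wnonneg_wunif.
- move=> x; rewrite expect_wunif.
  case: (boolP (x == N%:Z)) => [/eqP ->|xN].
    rewrite eqxx big1 ?mulr0 ?add0r ?mulr1; first by lra.
    by move=> i _; rewrite eqz_nat ltn_eqF.
  rewrite eq_sym (negbTE xN) mulr0 addr0 -[leRHS]mulr1 ler_wpM2l //; first by lra.
  rewrite -natr_sum lern1 leqNgt; apply/negP => h.
  have [i ix] : exists i : 'I_N, i%:Z == x.
    apply/existsP; apply: contraTT h; rewrite negb_exists => /forallP h.
    by rewrite big1 // => i _; rewrite (negbTE (h i)).
  move: h; rewrite (bigD1 i) //= ix big1 // => j ji.
  by rewrite -(eqP ix) eqz_nat (inj_eq (@ord_inj _)) (negbTE ji).
- by rewrite expect_wunif sumr_const card_ord; lra.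
Qed.

(** * Sums of several independent terms *)

(** Indexed by a list, so that a sum can be cut into two halves; the empty sum is the unit mass at
    0. *)
Definition wconvs (R : realFieldType) (G : zmodType) (I : Type) (r : seq I)
    (l : I -> seq (G * R)) : seq (G * R) :=
  foldr (fun i => wconv (l i)) [:: (0, 1)] r.

Lemma expect_wconvs_cons (R : realFieldType) (G : zmodType) (I : Type) (i : I)
    (r : seq I) (l : I -> seq (G * R)) (h : G -> R) :
  expect (wconvs (i :: r) l) h
  = expect (l i) (fun x => expect (wconvs r l) (fun y => h (x + y))).
Proof. exact: expect_conv. Qed.

Lemma expect_wconvs_nil (R : realFieldType) (G : zmodType) (I : Type)
    (l : I -> seq (G * R)) (h : G -> R) : expect (wconvs [::] l) h = h 0.
Proof. by rewrite /expect big_seq1 mul1r. Qed.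

Lemma expect_wconvs_cat (R : realFieldType) (G : zmodType) (I : Type) (r1 r2 : seq I)
    (l : I -> seq (G * R)) (h : G -> R) :
  expect (wconvs (r1 ++ r2) l) h = expect (wconv (wconvs r1 l) (wconvs r2 l)) h.
Proof.
rewrite expect_conv; elim: r1 h => [|i r IH] h.
  by rewrite expect_wconvs_nil; apply: eq_expect => y; rewrite add0r.
rewrite cat_cons !expect_wconvs_cons; apply: eq_expect => x; rewrite IH.
by apply: eq_expect => y; apply: eq_expect => z; rewrite addrA.
Qed.

Lemma wnonneg_wconvs (R : realFieldType) (G : zmodType) (I : Type) (r : seq I)
    (l : I -> seq (G * R)) : (forall i, wnonneg (l i)) -> wnonneg (wconvs r l).
Proof.
by move=> h; elim: r => [|i r IH]; [rewrite /= ler01|rewrite wnonneg_conv].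
Qed.

Lemma wconvs_self_concentrated (R : realFieldType) (I : Type) (r : seq I)
    (u : I -> seq (int * R)) :
  (forall i, wnonneg (u i)) -> (forall i, concentrated (u i) (u i)) ->
  concentrated (wconvs r u) (wconvs r u).
Proof.
move=> u0 cu; elim: r => [S k Sk|i r IH]; last first.
  by apply: (concentrated_conv int_group_order); rewrite ?wnonneg_wconvs.
rewrite !expect_autocorr /expect !big_seq1 /= !mul1r !subr0.
by rewrite lern1 leq_b1.
Qed.

Lemma wconvs_concentrated (R : realFieldType) (G : zmodType) (lt : rel G) (I : Type)
    (r : seq I) (l : I -> seq (G * R)) (u : I -> seq (int * R)) :
  group_order lt -> (forall i, wnonneg (l i)) -> (forall i, wnonneg (u i)) ->
  (forall i, concentrated (l i) (u i)) -> (forall i, concentrated (u i) (u i)) ->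
  concentrated (wconvs r l) (wconvs r u).
Proof.
move=> olt l0 u0 lu cu; elim: r => [S k Sk|i r IH]; last first.
  apply: (concentrated_conv olt); rewrite ?wnonneg_wconvs //.
  exact: wconvs_self_concentrated.
rewrite !expect_autocorr /expect !big_seq1 /= !mul1r !subr0.
by rewrite lern1 leq_b1.
Qed.

Lemma expect_wconvs_opp (R : realFieldType) (G : zmodType) (I : Type) (r : seq I)
    (l : I -> seq (G * R)) (h : G -> R) :
  expect (wconvs r (fun i => wopp (l i))) h = expect (wconvs r l) (fun x => h (- x)).
Proof.
elim: r h => [|i r IH] h; first by rewrite !expect_wconvs_nil oppr0.
rewrite !expect_wconvs_cons expect_opp; apply: eq_expect => x.
by rewrite IH; apply: eq_expect => y; rewrite opprD.
Qed.

Lemma eq_wconvs (R : realFieldType) (G : zmodType) (I : eqType) (r : seq I)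
    (l1 l2 : I -> seq (G * R)) :
  {in r, l1 =1 l2} -> wconvs r l1 = wconvs r l2.
Proof.
elim: r => //= i r IH h; rewrite h ?mem_head // IH // => j jr.
by rewrite h // inE jr orbT.
Qed.

Lemma wconvs_const_size (R : realFieldType) (G : zmodType) (I : Type) (r1 r2 : seq I)
    (u : seq (G * R)) :
  size r1 = size r2 -> wconvs r1 (fun=> u) = wconvs r2 (fun=> u).
Proof. by elim: r1 r2 => [|i r1 IH] [|j r2] //= [/IH ->]. Qed.

(** Identifies the law of the alternating sum of the [U i] with an autocorrelation, once the indices
    are grouped by sign. *)
Lemma expect_wconvs_reflect (R : realFieldType) (G : zmodType) (I : eqType)
    (r1 r2 : seq I) (u : seq (G * R)) (l : I -> seq (G * R)) (h : G -> R) :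
  {in r1, forall i, l i = u} -> {in r2, forall i, l i = wopp u} ->
  size r1 = size r2 ->
  expect (wconvs (r1 ++ r2) l) h = expect (autocorr (wconvs r1 (fun=> u))) h.
Proof.
move=> l1 l2 sr; rewrite expect_wconvs_cat expect_autocorr expect_conv.
rewrite (eq_wconvs l1) (eq_wconvs l2); apply: eq_expect => x.
by rewrite expect_wconvs_opp (wconvs_const_size _ sr).
Qed.

(** Symmetrization replaces the sum by the autocorrelations of its two halves. Each is bounded by
    concentration at a single point, and equal sizes make the two bounds coincide. *)
Lemma expect_wconvs_eq_le (R : realFieldType) (G : zmodType) (lt : rel G) (I : Type)
    (r1 r2 : seq I) (l : I -> seq (G * R)) (u : seq (int * R)) (t : G) :
  group_order lt -> (forall i, wnonneg (l i)) -> wnonneg u ->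
  (forall i, concentrated (l i) u) -> concentrated u u -> size r1 = size r2 ->
  expect (wconvs (r1 ++ r2) l) (fun x => (x == t)%:R)
  <= expect (autocorr (wconvs r1 (fun=> u))) (fun y => (y == 0)%:R).
Proof.
move=> olt l0 u0 lu cu sr; rewrite expect_wconvs_cat.
apply: le_trans (expect_conv_eq_le _ _ _) _.
have bound r : expect (autocorr (wconvs r l)) (fun x => (x == 0)%:R)
    <= expect (autocorr (wconvs r (fun=> u))) (fun y => (y == 0)%:R).
  have := wconvs_concentrated r olt l0 (fun=> u0) lu (fun=> cu) (S := [:: 0]) (k := 0).
  move=> /(_ isT); congr (_ <= _); apply: eq_expect => x; first by rewrite inE.
  by rewrite normr_le0.
have := bound r1; have := bound r2; rewrite (wconvs_const_size _ sr); lra.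
Qed.

Local Open Scope classical_set_scope.
Local Open Scope ring_scope.

(** * The lexicographic order on row vectors *)

Definition lex_lt (R : realDomainType) (d : nat) (x y : 'rV[R]_d) : bool :=
  [exists i, (x 0 i < y 0 i) && [forall j : 'I_d, (j < i)%N ==> (x 0 j == y 0 j)]].

Lemma lex_ltP (R : realDomainType) (d : nat) (x y : 'rV[R]_d) :
  reflect (exists2 i, x 0 i < y 0 i & forall j : 'I_d, (j < i)%N -> x 0 j = y 0 j)
    (lex_lt x y).
Proof.
apply: (iffP existsP) => -[i].
  by case/andP=> xy /forallP h; exists i => // j ji; have /implyP/(_ ji)/eqP := h j.
by move=> xy h; exists i; rewrite xy; apply/forallP => j; apply/implyP => /h ->.
Qed.

Lemma lex_group_order (R : realDomainType) (d : nat) :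
  group_order (@lex_lt R d : rel 'rV[R]_d).
Proof.
split.
- by move=> x; apply/lex_ltP => -[i]; rewrite ltxx.
- move=> y x z /lex_ltP[i xy hi] /lex_ltP[j yz hj]; apply/lex_ltP.
  case: (ltngtP i j) => ij.
  + exists i => [|k ki]; first by rewrite -hj.
    by rewrite hi // hj // (ltn_trans ki).
  + exists j => [|k kj]; first by rewrite hi.
    by rewrite hi ?hj // (ltn_trans kj).
  + have e := ord_inj ij; exists i => [|k ki].
      by rewrite (lt_trans xy) // e.
    by rewrite hi // hj // -e.
- move=> x y xy.
  have [i0 i0P] : exists i, x 0 i != y 0 i.
    apply/existsP; apply: contraNT xy; rewrite negb_exists => /forallP h.
    by apply/eqP/rowP => i; apply/eqP; rewrite -[_ == _]negbK h.
  (* The least coordinate at which [x] and [y] differ decides the comparison. *)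
  case: (@arg_minnP _ i0 (fun i => x 0 i != y 0 i) (@nat_of_ord d) i0P) => i iP imin.
  have eqj (j : 'I_d) : (j < i)%N -> x 0 j = y 0 j.
    by move=> ji; apply/eqP; apply: contraTT ji => /imin; rewrite -leqNgt.
  case/orP: (lt_total iP) => h; apply/orP; [left|right]; apply/lex_ltP; exists i => // j ji.
  by rewrite eqj.
- move=> z x y /lex_ltP[i xy h]; apply/lex_ltP; exists i => [|j ji]; rewrite !mxE ?ltrD2r //.
  by rewrite h.
Qed.

(** * From independent variables to lists of atoms *)

(** [Q] may depend on the value of [X]: the event is a finite union over the values [a] in [s], with
    [Q a] fixed on each piece. *)
Lemma measurable_values (dO dT : measure_display) (Omega : measurableType dO)
    (T : measurableType dT) (X : Omega -> T) (s : seq T) (Q : T -> set Omega) :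
  (forall a, measurable (X @^-1` [set a] `&` Q a)) ->
  measurable [set w | X w \in s /\ Q (X w) w].
Proof.
move=> mQ; elim: s => [|a s IH].
  by rewrite (_ : mkset _ = set0) // -subset0 => w [].
rewrite (_ : mkset _ = (X @^-1` [set a] `&` Q a) `|` [set w | X w \in s /\ Q (X w) w]).
  exact: measurableU.
apply/seteqP; split => w /=; rewrite inE.
  by case=> /predU1P[->|ws] Qw; [left|right].
by case=> [[-> ?]|[-> ?]]; rewrite ?eqxx ?orbT.
Qed.

Lemma measure_values (dO dT : measure_display) (Omega : measurableType dO)
    (T : measurableType dT) (R : realType) (mu : {measure set Omega -> \bar R})
    (X : Omega -> T) (s : seq T) (Q : T -> set Omega) :
  uniq s -> (forall a, measurable (X @^-1` [set a] `&` Q a)) ->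
  mu [set w | X w \in s /\ Q (X w) w] =
  (\sum_(a <- s) mu (X @^-1` [set a] `&` Q a))%E.
Proof.
move=> + mQ; elim: s => [|a s IH] /=.
  by move=> _; rewrite big_nil (_ : mkset _ = set0) ?measure0 // -subset0 => w [].
case/andP=> /negP as_ us; rewrite big_cons -IH //.
rewrite -measureU //; last 2 first.
- exact: measurable_values.
- by rewrite -subset0 => w /= [[Xa _] [Xs _]]; apply: as_; rewrite -Xa.
congr (mu _); apply/seteqP; split => w /=; rewrite inE.
  by case=> /predU1P[->|ws] Qw; [left|right].
by case=> [[-> ?]|[-> ?]]; rewrite ?eqxx ?orbT.
Qed.

Definition cylinder (T Omega : Type) (I : finType) (X : I -> Omega -> T) (J : {set I})
    (A : I -> set T) : set Omega := \bigcap_(i in [set` J]) X i @^-1` A i.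

Lemma measurable_cylinder (dO dT : measure_display) (Omega : measurableType dO)
    (T : measurableType dT) (R : realType) (P : probability Omega R) (I : finType)
    (X : I -> {RV P >-> T}) (J : {set I}) (A : I -> set T) :
  (forall i, i \in J -> measurable (A i)) -> measurable (cylinder X J A).
Proof.
move=> mA; apply: fin_bigcap_measurable => // i iJ.
by rewrite -[X in measurable X]setTI; apply: measurable_funPT => //; apply: mA.
Qed.

Lemma indep_cylinder (dO dT : measure_display) (Omega : measurableType dO)
    (T : measurableType dT) (R : realType) (P : probability Omega R) (I : finType)
    (X : I -> {RV P >-> T}) (i : I) (J : {set I}) (A : I -> set T) (C : set T) :
  mutually_independent X -> i \notin J -> measurable C ->
  (forall j, j \in J -> measurable (A j)) ->
  P (X i @^-1` C `&` cylinder X J A) = (P (X i @^-1` C) * P (cylinder X J A))%E.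
Proof.
move=> indep iJ mC mA; pose A' j := if j == i then C else A j.
have A'E j : j \in J -> A' j = A j.
  by move=> jJ; rewrite /A'; case: eqP => // e; rewrite -e jJ in iJ.
have mA' j : j \in i |: J -> measurable (A' j).
  by rewrite /A' in_setU1; case: eqP => //= _; apply: mA.
have -> : X i @^-1` C `&` cylinder X J A = cylinder X (i |: J) A'.
  apply/seteqP; split => w.
    move=> [Cw Aw] j /=; rewrite in_setU1 => /predU1P[->|jJ]; first by rewrite /A' eqxx.
    by rewrite A'E //; apply: Aw.
  move=> Aw; split; first by have := Aw i; rewrite /A' eqxx; apply; rewrite /= in_setU1 eqxx.
  by move=> j jJ; rewrite -A'E //; apply: Aw; rewrite /= in_setU1 jJ orbT.
rewrite /cylinder !indep // big_setU1 //= {1}/A' eqxx; congr (_ * _)%E.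
by apply: eq_bigr => j jJ; rewrite A'E.
Qed.

(** The law of [X] cut down to [s] and transported by [g], in general of total mass below 1. The map
    [g] carries the sign of a summand. *)
Definition atoms (dO dT : measure_display) (Omega : measurableType dO)
    (T : measurableType dT) (R : realType) (P : probability Omega R)
    (G : zmodType) (X : Omega -> T) (g : T -> G) (s : seq T) : seq (G * R) :=
  [seq (g a, fine (P (X @^-1` [set a]))) | a <- s].

Lemma wnonneg_atoms (dO dT : measure_display) (Omega : measurableType dO)
    (T : measurableType dT) (R : realType) (P : probability Omega R)
    (G : zmodType) (X : Omega -> T) (g : T -> G) (s : seq T) :
  wnonneg (atoms P X g s).
Proof. by apply/allP => _ /mapP[a _ ->]; rewrite /= fine_ge0. Qed.

(** Recursive so as to unfold in step with [wconvs]; [sum_eventP] gives the closed form. *)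
Fixpoint sum_event (T Omega : eqType) (I : Type) (G : zmodType) (X : I -> Omega -> T)
    (g : I -> T -> G) (s : I -> seq T) (r : seq I) (t : G) : set Omega :=
  if r is i :: r' then
    [set w | X i w \in s i /\ sum_event X g s r' (t - g i (X i w)) w]
  else [set _ | t = 0].

Lemma sum_eventP (T Omega : eqType) (I : Type) (G : zmodType) (X : I -> Omega -> T)
    (g : I -> T -> G) (s : I -> seq T) (r : seq I) (t : G) :
  sum_event X g s r t =
  [set w | all (fun i => X i w \in s i) r /\ \sum_(i <- r) g i (X i w) = t].
Proof.
elim: r t => [|i r IH] t; apply/seteqP; split => w /=; rewrite ?big_nil ?big_cons ?IH /=.
- by move=> ->.
- by case.
- by move=> [-> [-> ->]]; rewrite addrC subrK.
- by move=> [/andP[-> ->] <-]; rewrite addrAC subrr add0r.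
Qed.

Lemma measurable_sum_event (dO dT : measure_display) (Omega : measurableType dO)
    (T : measurableType dT) (R : realType) (P : probability Omega R) (I : eqType)
    (G : zmodType) (X : I -> {RV P >-> T}) (g : I -> T -> G) (s : I -> seq T)
    (r : seq I) (t : G) :
  (forall a : T, measurable [set a]) -> measurable (sum_event X g s r t).
Proof.
move=> m1; elim: r t => [|i r IH] t /=.
  case: (eqVneq t 0) => [->|/eqP t0]; first by rewrite (_ : mkset _ = setT) // eqEsubset.
  by rewrite (_ : mkset _ = set0) // -subset0.
apply: (@measurable_values _ _ _ _ (X i) (s i) (fun a => sum_event X g s r (t - g i a))) => a.
apply: measurableI => //.
by rewrite -[X in measurable X]setTI; apply: measurable_funPT.
Qed.

(** The cylinder is there for the induction on [r]: it records the constraints on variables already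
    treated, and fixing [X i = a] moves [i] from [r] into [J]. *)
Lemma sum_event_cylinder (dO dT : measure_display) (Omega : measurableType dO)
    (T : measurableType dT) (R : realType) (P : probability Omega R) (I : finType)
    (G : zmodType) (X : I -> {RV P >-> T}) (g : I -> T -> G) (s : I -> seq T)
    (r : seq I) (t : G) (J : {set I}) (A : I -> set T) :
  mutually_independent X -> (forall a : T, measurable [set a]) ->
  (forall i, uniq (s i)) -> uniq r -> (forall i, i \in r -> i \notin J) ->
  (forall j, j \in J -> measurable (A j)) ->
  P (cylinder X J A `&` sum_event X g s r t) =
  ((expect (wconvs r (fun i => atoms P (X i) (g i) (s i))) (fun y => (y == t)%:R))%:E
   * P (cylinder X J A))%E.
Proof.
move=> indep m1 us; elim: r t J A => [|i r IH] t J A ur rJ mA.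
  rewrite expect_wconvs_nil eq_sym /=; case: (eqVneq t 0) => [->|/eqP t0].
    by rewrite mul1e (_ : mkset _ = setT) ?setIT // eqEsubset.
  by rewrite mul0e (_ : mkset _ = set0) ?setI0 ?measure0 // -subset0.
have iJ : i \notin J by rewrite rJ ?mem_head.
have [ir ur'] : i \notin r /\ uniq r by move: ur => /= /andP.
pose Aa a j := if j == i then [set a] else A j.
have mAa a j : j \in i |: J -> measurable (Aa a j).
  by rewrite /Aa in_setU1; case: eqP => //= _; apply: mA.
have cylE a : cylinder X (i |: J) (Aa a) = X i @^-1` [set a] `&` cylinder X J A.
  apply/seteqP; split => w.
    move=> Aw; split; first by have := Aw i; rewrite /Aa eqxx; apply; rewrite /= in_setU1 eqxx.
    move=> j /= jJ; have := Aw j; rewrite /Aa; case: eqP => [e|_].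
      by rewrite e (negbTE iJ) in jJ.
    by apply; rewrite /= in_setU1 jJ orbT.
  move=> [Xa Aw] j /=; rewrite in_setU1 /Aa; case: eqP => [->//|_ /=]; exact: Aw.
have split_set : cylinder X J A `&` sum_event X g s (i :: r) t =
    [set w | X i w \in s i /\
      (cylinder X J A `&` sum_event X g s r (t - g i (X i w))) w].
  by apply/seteqP; split => w /= => [[? [? ?]]|[? [? ?]]].
have mX a : measurable (X i @^-1` [set a]).
  by rewrite -[X in measurable X]setTI; apply: measurable_funPT.
rewrite split_set (@measure_values _ _ _ _ _ P (X i) (s i)
  (fun a => cylinder X J A `&` sum_event X g s r (t - g i a))) //; last first.
  move=> a; apply: measurableI => //; apply: measurableI; last exact: measurable_sum_event.
  exact: measurable_cylinder.
rewrite expect_wconvs_cons {1}/expect {1}/atoms big_map /= -sumEFin ge0_sume_distrl; last first.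
  move=> a _; rewrite lee_fin mulr_ge0 ?fine_ge0 // expect_ge0 // ?wnonneg_wconvs // => j.
  exact: wnonneg_atoms.
apply: eq_bigr => a _; rewrite setIA -cylE IH //; last 2 first.
- move=> j jr; rewrite in_setU1 negb_or rJ ?inE ?jr ?orbT // andbT.
  by apply: contraNneq ir => <-.
- exact: mAa.
rewrite cylE indep_cylinder // muleA; congr (_ * _)%E.
rewrite EFinM [RHS]muleC; congr (_ * _)%E; last first.
  by apply/esym/fineK/fin_num_measure.
congr (_%:E)%E; apply: eq_expect => y.
by rewrite eq_sym subr_eq eq_sym addrC.
Qed.

(** * Fubini and independence from the remaining variables *)

(** Independence makes the joint law a product measure, and by Fubini the probability of [D] is the
    mean over [Y] of the probabilities of its sections. *)
Lemma indep_section_bound (dO dT dS : measure_display) (Omega : measurableType dO)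
    (T : measurableType dT) (S : measurableType dS) (R : realType)
    (P : probability Omega R) (X : {RV P >-> T}) (Y : {RV P >-> S})
    (D : set (T * S)) (c : R) :
  (forall A B, measurable A -> measurable B ->
     P (X @^-1` A `&` Y @^-1` B) = (P (X @^-1` A) * P (Y @^-1` B))%E) ->
  measurable D -> 0 <= c ->
  (forall y, (P (X @^-1` [set x | D (x, y)]) <= c%:E)%E) ->
  (P [set w | D (X w, Y w)] <= c%:E)%E.
Proof.
move=> indep mD c0 Dc.
have mXY : measurable_fun setT (fun w => (X w, Y w)).
  by apply/measurable_fun_pairP; split; apply: measurable_funPT.
pose XY : {mfun Omega >-> (T * S)%type} :=
  HB.pack_for {mfun Omega >-> (T * S)%type} (fun w => (X w, Y w))
    (isMeasurableFun.Build _ _ _ _ (fun w => (X w, Y w)) mXY).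
have E : (distribution P X \x distribution P Y)%E D = distribution P XY D.
  apply: product_measure_unique => // A B mA mB; exact: indep.
rewrite (_ : P _ = distribution P XY D) // -E.
(* The order of integration is exchanged so that the sections are taken at fixed [y]. *)
have -> : (distribution P X \x distribution P Y)%E D
          = (distribution P X \x^ distribution P Y)%E D.
  by apply: product_measure_unique => // A B mA mB; exact: product_measure2E.
rewrite -[leRHS]mule1 -(probability_setT (distribution P Y)) -integral_cst //.
apply: ge0_le_integral => //.
- exact: measurable_fun_ysection.
- by move=> y _; rewrite /= ysectionE; apply: Dc.
Qed.

(* A pi-system that generates the sigma-algebra of the X_j with j != i. *)
Definition others (dO dT : measure_display) (Omega : measurableType dO)
    (T : measurableType dT) (R : realType) (P : probability Omega R) (I : finType)
    (X : I -> {RV P >-> T}) (i : I) : set (set Omega) :=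
  [set cylinder X [set~ i] A | A in [set A | forall j, measurable (A j)]].

Lemma others_setI_closed (dO dT : measure_display) (Omega : measurableType dO)
    (T : measurableType dT) (R : realType) (P : probability Omega R) (I : finType)
    (X : I -> {RV P >-> T}) (i : I) : setI_closed (others X i).
Proof.
move=> _ _ [A mA <-] [B mB <-]; exists (fun j => A j `&` B j) => [j|].
  exact: measurableI.
apply/seteqP; split => [w AB|w [Aw Bw] j jJ]; last by split; [apply: Aw|apply: Bw].
by split => j jJ; have [] := AB j jJ.
Qed.

(** With [A] fixed, both sides are finite measures in [B] that agree on a pi-system, hence on the
    sigma-algebra it generates. *)
Lemma indep_others (dO dT : measure_display) (Omega : measurableType dO)
    (T : measurableType dT) (R : realType) (P : probability Omega R) (I : finType)
    (X : I -> {RV P >-> T}) (i : I) (A : set T) (B : set Omega) :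
  mutually_independent X -> measurable A -> <<s others X i >> B ->
  P (X i @^-1` A `&` B) = (P (X i @^-1` A) * P B)%E.
Proof.
move=> indep mA.
have mXA : measurable (X i @^-1` A).
  by rewrite -[X in measurable X]setTI; apply: measurable_funPT.
have p0 : 0 <= fine (P (X i @^-1` A)) by rewrite fine_ge0.
have sub : others X i `<=` measurable.
  by move=> _ [C mC <-]; apply: measurable_cylinder.
move=> sB; rewrite -(fineK (fin_num_measure P _ mXA)) setIC.
have := @g_sigma_algebra_measure_unique _ _ _ (others X i) sub (fun=> setT) _ _
  (mrestr P mXA) (mscale (NngNum p0) P) _ _ _ B sB.
apply.
- move=> _; exists (fun=> setT) => //; rewrite -subTset => w _ j _ //.
- by apply: bigcup_const; exists 0%N.
- exact: others_setI_closed.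
- move=> _ [C mC <-].
  rewrite -[LHS]/(P (cylinder X [set~ i] C `&` X i @^-1` A)).
  rewrite -[RHS]/((fine (P (X i @^-1` A)))%:E * P (cylinder X [set~ i] C))%E.
  rewrite fineK ?fin_num_measure // setIC.
  by apply: indep_cylinder => //; rewrite !inE eqxx.
- move=> k; rewrite -[ltLHS]/(P (setT `&` X i @^-1` A)) setTI.
  by rewrite (le_lt_trans (probability_le1 _ _)) ?ltry.
Qed.

(** * Borel vectors and truncation to finitely many atoms *)

Lemma measurable_coord (R : realType) (d : nat) (c : 'I_d) :
  measurable_fun [set: borel_vector R d] (fun v : borel_vector R d => (v : 'rV[R]_d) 0 c).
Proof.
apply: (measurability _ (RGenOInfty.measurableE R)) => _ [_ [a ->] <-].
rewrite setTI; apply: sub_sigma_algebra.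
have /continuousP := @coord_continuous R 1 d 0 c; apply; rewrite set_itvE; exact: open_gt.
Qed.

Lemma measurable_point (R : realType) (d : nat) (a : borel_vector R d) :
  measurable [set a].
Proof.
rewrite (_ : [set a] = \bigcap_(c in [set: 'I_d])
    ((fun v : borel_vector R d => (v : 'rV[R]_d) 0 c) @^-1` [set (a : 'rV[R]_d) 0 c])).
  apply: fin_bigcap_measurable => // c _; rewrite -[X in measurable X]setTI.
  exact: measurable_coord.
apply/seteqP; split => [v -> c _ //|v va]; apply/rowP => c.
exact: va.
Qed.

(** Otherwise points of mass above [eps] could be collected without end, and more than [eps^-1] of
    them have total mass above 1. *)
Lemma exists_large_atoms (dO dT : measure_display) (Omega : measurableType dO)
    (T : measurableType dT) (R : realType) (P : probability Omega R)
    (X : {RV P >-> T}) (eps : R) :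
  (forall a : T, measurable [set a]) -> 0 < eps ->
  exists s : seq T, uniq s /\ forall a, a \notin s -> (P (X @^-1` [set a]) <= eps%:E)%E.
Proof.
move=> m1 eps0; apply: contrapT => none.
have more (s : seq T) : uniq s -> exists2 a, a \notin s & (eps%:E < P (X @^-1` [set a]))%E.
  move=> us; apply: contrapT => h; apply: none; exists s; split => // a as_.
  by rewrite leNgt; apply/negP => ha; apply: h; exists a.
have large k : exists s : seq T, [/\ uniq s, size s = k &
    forall a, a \in s -> (eps%:E <= P (X @^-1` [set a]))%E].
  elim: k => [|k [s [us sk hs]]]; first by exists [::].
  have [a as_ ha] := more s us; exists (a :: s); split; rewrite /= ?as_ ?sk //.
  by move=> b; rewrite inE => /predU1P[->|/hs//]; apply: ltW.
have mX (a : T) : measurable (X @^-1` [set a] `&` setT).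
  by rewrite setIC; apply: measurable_funPT.
have [s [us sk hs]] := large (Num.bound eps^-1).
have := probability_le1 P (measurable_values s mX).
rewrite (measure_values _ us mX) leNgt => /negP; apply.
apply: (@lt_le_trans _ _ (\sum_(a <- s) eps%:E)%E); last first.
  by rewrite big_seq [leRHS]big_seq; apply: lee_sum => a /hs; rewrite setIT.
rewrite sumEFin lte_fin big_const_seq count_predT iter_addr_0 sk -mulr_natr.
rewrite -ltr_pdivrMl // mulr1.
by apply: archi_boundP; rewrite invr_ge0 ltW.
Qed.

(** Given the other variables, the event forces [X i] to take one value outside [s], which has
    probability at most [eps]. *)
Lemma nonatomic_part_le (R : realType) (dP : measure_display)
    (Omega : measurableType dP) (P : probability Omega R) (I : finType) (d : nat)
    (X : I -> {RV P >-> borel_vector R d}) (i : I) (s : seq (borel_vector R d))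
    (eps : R) (x : 'rV[R]_d) :
  mutually_independent X -> 0 <= eps ->
  (forall a, a \notin s -> (P (X i @^-1` [set a]) <= eps%:E)%E) ->
  (P [set w | X i w \notin s /\ (\sum_j (X j w : 'rV[R]_d))%R = x] <= eps%:E)%E.
Proof.
move=> indep eps0 small.
(* [S] is [Omega] with the sigma-algebra of the other variables, and [Y] is the identity into it:
   one random element that stands for all of them. *)
pose S := g_sigma_algebraType (others X i).
have sub : others X i `<=` measurable by move=> _ [C mC <-]; apply: measurable_cylinder.
have mid : measurable_fun setT (fun w : Omega => w : S).
  by move=> _ A /= mA; rewrite setTI; apply: (smallest_sub (@sigma_algebra_measurable _ Omega) sub).
pose Y : {RV P >-> S} := HB.pack_for {mfun Omega >-> S} (fun w : Omega => w : S)
  (isMeasurableFun.Build _ _ _ _ (fun w : Omega => w : S) mid).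
pose rest (w : S) : 'rV[R]_d := \sum_(j | j != i) (X j w : 'rV[R]_d).
pose D := [set p : borel_vector R d * S | p.1 \notin s /\ (p.1 : 'rV[R]_d) + rest p.2 = x].
have mX j : j != i -> measurable_fun setT (fun w : S => X j w).
  move=> ji _ A mA; rewrite setTI; apply: sub_sigma_algebra.
  exists (fun k => if k == j then A else setT) => [k|]; first by case: ifP.
  apply/seteqP; split => [w h|w Aw k _].
    by have := h j; rewrite /= eqxx; apply; rewrite !inE.
  by case: eqP => [->|].
have mD : measurable D.
  rewrite (_ : D = (fst @^-1` (~` [set` s])) `&`
    \bigcap_(c in [set: 'I_d]) [set p | (p.1 : 'rV[R]_d) 0 c + rest p.2 0 c = x 0 c]).
    apply: measurableI.
      rewrite -[X in measurable X]setTI; apply: measurable_fst => //.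
      apply: measurableC; elim: s {small D} => [|a s IH].
        by rewrite (_ : [set` _] = set0) // -subset0.
      rewrite (_ : [set` _] = [set a] `|` [set` s]).
        by apply: measurableU => //; apply: measurable_point.
      apply/seteqP; split => b /=; rewrite inE.
        by case/predU1P => h; [left|right].
      by case=> [->|->]; rewrite ?eqxx ?orbT.
    apply: fin_bigcap_measurable => // c _.
    have mf : measurable_fun [set: borel_vector R d * S]
        (fun p : borel_vector R d * S => (p.1 : 'rV[R]_d) 0 c + rest p.2 0 c).
      apply: measurable_funD.
        exact: measurableT_comp (measurable_coord c) (@measurable_fst _ _ _ _).
      apply: (@measurableT_comp _ _ _ _ _ _ (fun w : S => rest w 0 c)) => //.
      rewrite (_ : (fun w : S => rest w 0 c) = fun w : S =>
          \sum_(j <- index_enum I) if j != i then (X j w : 'rV[R]_d) 0 c else 0).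
        apply: measurable_sum => j; case: (boolP (j != i)) => ji //.
        exact: measurableT_comp (measurable_coord c) (mX j ji).
      by apply/funext => w; rewrite /rest summxE big_mkcond.
    by have := mf measurableT _ (measurable_set1 (x 0 c)); rewrite setTI.
  apply/seteqP; split => p /=.
    by move=> [ps e]; split => [|c _]; [exact/negP|rewrite -e mxE].
  by move=> [ps e]; split; [exact/negP|apply/rowP => c; rewrite mxE e].
have -> : [set w | X i w \notin s /\ (\sum_j (X j w : 'rV[R]_d))%R = x]
    = [set w | D (X i w, Y w)].
  by apply/funext => w; rewrite /D /= /rest (bigD1 i).
apply: indep_section_bound => //.
  by move=> A B mA mB; apply: indep_others.
(* The section at [w] is contained in the single point [x - rest w], and is empty if that point
   belongs to [s]. *)
move=> w; case: (boolP (x - rest w \in s)) => ws.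
  rewrite (_ : _ @^-1` _ = set0) ?measure0 // -subset0 => v [vs e].
  by rewrite -e addrK (negbTE vs) in ws.
apply: le_trans (small _ ws); apply: le_measure; rewrite ?inE.
- have := measurable_ysection (w : S) mD; rewrite ysectionE => mDw.
  by rewrite -[X in measurable X]setTI; apply: measurable_funPT.
- rewrite -[X in measurable X]setTI; apply: measurable_funPT => //.
  exact: measurable_point.
- by move=> v [_ <-]; rewrite /= addrK.
Qed.

Lemma atoms_mass_le (dO dT : measure_display) (Omega : measurableType dO)
    (T : measurableType dT) (R : realType) (P : probability Omega R)
    (X : {RV P >-> T}) (s : seq T) :
  uniq s -> (forall a : T, measurable [set a]) ->
  \sum_(a <- s) fine (P (X @^-1` [set a])) <= 1.
Proof.
move=> us m1.
have mX a : measurable (X @^-1` [set a]).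
  by rewrite -[X in measurable X]setTI; apply: measurable_funPT.
have mXT (a : T) : measurable (X @^-1` [set a] `&` setT) by rewrite setIT.
have := probability_le1 P (measurable_values s mXT).
rewrite (measure_values _ us mXT) -lee_fin -sumEFin; apply: le_trans.
rewrite le_eqVlt; apply/orP; left; apply/eqP; apply: eq_bigr => a _.
by rewrite setIT; apply/fineK/fin_num_measure.
Qed.

(** A union bound, one index at a time. The exceptional events are intersected with [E] because
    lying outside [s i] need not be unlikely by itself: without atoms it is almost sure. *)
Lemma measure_le_all_mem (dO dT : measure_display) (Omega : measurableType dO)
    (T : measurableType dT) (R : realType) (P : probability Omega R) (I : eqType)
    (X : I -> {RV P >-> T}) (r : seq I) (s : I -> seq T) (eps : R) (E : set Omega) :
  measurable E -> (forall i, i \in r -> measurable [set w | X i w \in s i]) ->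
  (forall i, i \in r -> (P [set w | X i w \notin s i /\ E w] <= eps%:E)%E) ->
  (P E <= P [set w | all (fun i => X i w \in s i) r /\ E w] + (eps * (size r)%:R)%:E)%E.
Proof.
elim: r => [|i r IH] mE ms small.
  rewrite mulr0 adde0 (_ : mkset _ = E) //.
  by apply/seteqP; split => w //= [].
have ir : i \in i :: r by rewrite mem_head.
have sub j : j \in r -> j \in i :: r by rewrite inE => ->; rewrite orbT.
have mall : measurable [set w | all (fun i => X i w \in s i) r /\ E w].
  elim: r ms {IH small ir sub} => [|j r IH] ms.
    by rewrite (_ : mkset _ = E) //; apply/seteqP; split => w //= [].
  rewrite (_ : mkset _ = [set w | X j w \in s j] `&`
      [set w | all (fun i => X i w \in s i) r /\ E w]).
    apply: measurableI; first by apply: ms; rewrite !inE eqxx orbT.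
    by apply: IH => k kr; apply: ms; move: kr; rewrite !inE => /orP[->|->]; rewrite ?orbT.
  by apply/seteqP; split => w /=; [move=> [/andP[]]|move=> [-> []]].
apply: le_trans (IH mE (fun j jr => ms j (sub j jr)) (fun j jr => small j (sub j jr))) _.
rewrite /= -[(size r).+1]addn1 natrD mulrDr mulr1 EFinD addeA.
rewrite [in leRHS]addeAC; apply: leeD2r.
set A := [set w | X i w \in s i]; set B := [set w | all _ r /\ E w].
have mA : measurable A by apply: ms.
rewrite (measureDI P mall mA) addeC; apply: leeD; last first.
  rewrite le_eqVlt; apply/orP; left; apply/eqP; congr (P _).
  by apply/seteqP; split => w /=; [move=> [[? ?] ?]; split => //; apply/andP|move=> [/andP[? ?] ?]].
apply: le_trans (small i ir); apply: le_measure; rewrite ?inE.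
- exact: measurableD.
- rewrite (_ : mkset _ = E `\` A); first exact: measurableD.
  by apply/seteqP; split => w /= [h1 h2]; split => //; apply/negP.
- by move=> w [[_ Ew] nA]; split => //; apply/negP.
Qed.

(** * Parity of the indices and the final estimate *)

Lemma parity_filter_size (n : nat) : ~~ odd n ->
  size [seq i : 'I_n <- enum 'I_n | ~~ odd i] = size [seq i : 'I_n <- enum 'I_n | odd i].
Proof.
have count_val (p : pred nat) :
    size [seq i : 'I_n <- enum 'I_n | p i] = count p (iota 0 n).
  by rewrite size_filter -val_enum_ord count_map.
rewrite (count_val (predC odd)) (count_val odd) => /even_halfK <-.
elim: n./2 => // m IH; rewrite doubleS -addn2 iotaD !count_cat IH add0n /=.
by rewrite odd_double.
Qed.

Lemma atoms_U (dQ : measure_display) (Omega : measurableType dQ) (R : realType)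
    (Q : probability Omega R) (U : {RV Q >-> int}) (alpha : R) (N i : nat) :
  Num.floor alpha^-1 = N%:Z -> has_law_U alpha U ->
  atoms Q U (fun a => (-1) ^+ i * a : int) [seq k%:Z | k <- iota 0 N.+1]
  = if odd i then wopp (wunif alpha N) else wunif alpha N.
Proof.
rewrite /has_law_U => -> [lo hi].
have -> : iota 0 N.+1 = rcons (iota 0 N) N by rewrite -addn1 iotaD cats1.
rewrite /atoms /wunif /wopp !map_rcons -!map_comp.
have fN : fine (Q (U @^-1` [set N%:Z])) = 1 - alpha * N%:R by rewrite hi.
have fk k : (k \in iota 0 N) -> fine (Q (U @^-1` [set k%:Z])) = alpha.
  by rewrite mem_iota add0n => /andP[_ kN]; rewrite lo //; lia.
rewrite -signr_odd; case: (odd i); rewrite fN ?mulN1r ?mul1r; congr rcons.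
  by apply/eq_in_map => k kN /=; rewrite fk // mulN1r.
by apply/eq_in_map => k kN /=; rewrite fk // mul1r.
Qed.

Lemma measurable_vector_sum_eq (R : realType) (dP : measure_display)
    (Omega : measurableType dP) (P : probability Omega R) (I : finType) (d : nat)
    (X : I -> {RV P >-> borel_vector R d}) (x : 'rV[R]_d) :
  measurable [set w | (\sum_i (X i w : 'rV[R]_d))%R = x].
Proof.
rewrite (_ : mkset _ = \bigcap_(c in [set: 'I_d])
    [set w | \sum_i (X i w : 'rV[R]_d) 0 c = x 0 c]); last first.
  apply/seteqP; split => w /= => [<- c _|h]; first by rewrite summxE.
  by apply/rowP => c; rewrite summxE; apply: h.
apply: fin_bigcap_measurable => // c _.
have mf : measurable_fun [set: Omega] (fun w => \sum_i (X i w : 'rV[R]_d) 0 c).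
  apply: measurable_sum => i.
  exact: measurableT_comp (measurable_coord c) (measurable_funPT (X i)).
by have := mf measurableT _ (measurable_set1 (x 0 c)); rewrite setTI.
Qed.

Lemma measure_sum_event (dO dT : measure_display) (Omega : measurableType dO)
    (T : measurableType dT) (R : realType) (P : probability Omega R) (I : finType)
    (G : zmodType) (X : I -> {RV P >-> T}) (g : I -> T -> G) (s : I -> seq T)
    (r : seq I) (t : G) :
  mutually_independent X -> (forall a : T, measurable [set a]) ->
  (forall i, uniq (s i)) -> uniq r ->
  P (sum_event X g s r t) =
  (expect (wconvs r (fun i => atoms P (X i) (g i) (s i))) (fun y => (y == t)%:R))%:E.
Proof.
move=> indep m1 us ur.
have := sum_event_cylinder g t (J := finset.set0) (A := fun=> setT) indep m1 us ur.
have -> : cylinder X finset.set0 (fun=> setT) = setT.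
  by rewrite -subTset => w _ i; rewrite /= inE.
by rewrite setTI probability_setT mule1; apply => i; rewrite inE.
Qed.

Lemma expect_atoms_eq_le (R : realType) (dP dT : measure_display)
    (Omega : measurableType dP) (T : measurableType dT) (P : probability Omega R)
    (G : zmodType) (X : {RV P >-> T}) (g : T -> G) (s : seq T) (alpha : R) (y : G) :
  injective g -> uniq s -> (forall a : T, measurable [set a]) -> 0 <= alpha ->
  (forall a, (P (X @^-1` [set a]) <= alpha%:E)%E) ->
  expect (atoms P X g s) (fun x => (x == y)%:R) <= alpha.
Proof.
move=> ginj us m1 alpha0 Xa; rewrite /expect big_map /=.
case: (boolP (y \in [seq g a | a <- s])) => [/mapP[b bs ->]|ys].
  rewrite (bigD1_seq b) //= eqxx mulr1 big1 ?addr0 => [|a ab]; last first.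
    by rewrite (inj_eq ginj) (negbTE ab) mulr0.
  rewrite -lee_fin fineK // fin_num_measure // -[X in measurable X]setTI.
  exact: measurable_funPT.
rewrite big1_seq // => a /andP[_ as_]; case: eqP => [e|_]; last by rewrite mulr0.
by rewrite -e map_f in ys.
Qed.

Lemma measurable_int_sum_eq (dO : measure_display) (Omega : measurableType dO)
    (R : realType) (P : probability Omega R) (I : Type) (G : zmodType)
    (U : I -> {RV P >-> int}) (g : I -> int -> G) (r : seq I) (t : G) :
  measurable [set w | (\sum_(i <- r) g i (U i w))%R = t].
Proof.
elim: r t => [|i r IH] t.
  case: (eqVneq t 0) => [->|/eqP t0].
    by rewrite (_ : mkset _ = setT) // -subTset => w _ /=; rewrite big_nil.
  by rewrite (_ : mkset _ = set0) // -subset0 => w /=; rewrite big_nil => /esym.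
rewrite (_ : mkset _ = \bigcup_(a in [set: int]) (U i @^-1` [set a] `&`
    [set w | (\sum_(j <- r) g j (U j w))%R = t - g i a])).
  apply: countable_bigcupT_measurable => // a; apply: measurableI => //.
  by rewrite -[X in measurable X]setTI; apply: measurable_funPT.
apply/seteqP; split => w /=; rewrite big_cons.
  by move=> <-; exists (U i w) => //; split => //=; rewrite addrAC subrr add0r.
by move=> [a _ [/= -> ->]]; rewrite addrC subrK.
Qed.

(* Indices start at 0, so the sign of the i-th summand is (-1) ^+ i. *)
Theorem theorem1 (R : realType) (n d : nat) (n_gt0 : (0 < n)%N)
    (n_even : ~~ odd n) (alpha : R) (alpha01 : 0 < alpha < 1)
    (dP : measure_display) (Omega : measurableType dP)
    (P : probability Omega R) (X : 'I_n -> {RV P >-> borel_vector R d})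
    (X_indep : mutually_independent X)
    (X_conc : forall i : 'I_n,
      (ereal_sup (range (fun x : 'rV[R]_d => P [set w | X i w = x]))
         <= alpha%:E)%E)
    (dQ : measure_display) (Omega' : measurableType dQ)
    (Q : probability Omega' R) (U : 'I_n -> {RV Q >-> int})
    (U_indep : mutually_independent U)
    (U_law : forall i : 'I_n, has_law_U alpha (U i))
    (x : 'rV[R]_d) :
  (P [set w | (\sum_(i < n) (X i w : 'rV[R]_d))%R = x]
     <= Q [set w | (\sum_(i < n) (-1) ^+ i * U i w)%R = 0%R])%E.
Proof.
have [a0 a1] := andP alpha01.
have [N floorN] : exists N : nat, Num.floor alpha^-1 = N%:Z.
  exists `|Num.floor alpha^-1|%N; rewrite gez0_abs // floor_ge0 invr_ge0 ltW //.
have aN : 0 <= 1 - alpha * N%:R <= alpha.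
  have := floor_itv alpha^-1; rewrite floorN intrD -!pmulrn.
  rewrite -[X in (_ <= X < _) -> _]mul1r ler_pdivlMr // ltr_pdivrMr // => /andP[h1 h2].
  by lra.
pose r1 := [seq i : 'I_n <- enum 'I_n | ~~ odd i].
pose r2 := [seq i : 'I_n <- enum 'I_n | odd i].
have sr : size r1 = size r2 by apply: parity_filter_size.
have perm_r : perm_eq (r1 ++ r2) (enum 'I_n).
  by rewrite perm_catC; apply/permPl/(perm_filterC (fun i : 'I_n => odd i)).
have ur : uniq (r1 ++ r2) by rewrite (perm_uniq perm_r) enum_uniq.
have sum_r (V : zmodType) (F : 'I_n -> V) : \sum_(i <- r1 ++ r2) F i = \sum_i F i.
  by rewrite (perm_big _ perm_r) big_enum.
pose u : seq (int * R) := wunif alpha N.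
pose bound := expect (autocorr (wconvs r1 (fun=> u))) (fun y => (y == 0)%:R).
have lower : (bound%:E <= Q [set w | (\sum_(i < n) (-1) ^+ i * U i w)%R = 0%R])%E.
  pose g (i : 'I_n) (a : int) : int := (-1) ^+ i * a.
  pose sU (i : 'I_n) := [seq k%:Z | k <- iota 0 N.+1].
  have m1 (a : int) : measurable [set a] by [].
  have usU i : uniq (sU i) by rewrite map_inj_uniq ?iota_uniq // => j k [].
  have -> : bound%:E = Q (sum_event U g sU (r1 ++ r2) 0).
    rewrite measure_sum_event // (expect_wconvs_reflect (u := u)) // => i.
      rewrite mem_filter => /andP[io _].
      by rewrite /g /sU (atoms_U i floorN (U_law i)) (negbTE io).
    rewrite mem_filter => /andP[io _].
    by rewrite /g /sU (atoms_U i floorN (U_law i)) io.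
  apply: le_measure; rewrite ?inE.
  - exact: measurable_sum_event.
  - by have := measurable_int_sum_eq U g (r1 ++ r2) 0; under eq_set do rewrite sum_r.
  - by rewrite sum_eventP => w /= [_]; rewrite sum_r.
apply: le_trans lower; apply/lee_addgt0Pr => e e0.
pose eps := e / n%:R.
have eps0 : 0 < eps by rewrite divr_gt0 // ltr0n.
have m1 := @measurable_point R d.
have /choice[s sP] : forall i : 'I_n, exists s : seq (borel_vector R d),
    uniq s /\ forall a, a \notin s -> (P (X i @^-1` [set a]) <= eps%:E)%E.
  by move=> i; apply: exists_large_atoms.
have us i : uniq (s i) by have [] := sP i.
have Xa i (a : borel_vector R d) : (P (X i @^-1` [set a]) <= alpha%:E)%E.
  by apply: le_trans (X_conc i); apply: ereal_sup_ubound; exists a.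
have mE := measurable_vector_sum_eq X x.
have := measure_le_all_mem (X := X) (r := r1 ++ r2) (s := s) (eps := eps) mE.
rewrite (perm_size perm_r) size_enum_ord divfK ?gt_eqF ?ltr0n // => H.
apply: le_trans (H _ _) _.
- move=> i _; rewrite (_ : mkset _ = [set w | X i w \in s i /\ setT w]).
    apply: (@measurable_values _ _ _ _ (X i) (s i) (fun=> setT)) => a.
    by rewrite setIC; apply: measurable_funPT.
  by apply/seteqP; split => w //= [].
- move=> i _; apply: nonatomic_part_le => //; first exact: ltW.
  by have [] := sP i.
apply: leeD => //.
pose g (i : 'I_n) (v : borel_vector R d) : 'rV[R]_d := v.
rewrite [X in P X](_ : _ = sum_event X g s (r1 ++ r2) x); last first.
  by rewrite sum_eventP; apply/funext => w /=; rewrite sum_r.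
rewrite measure_sum_event // lee_fin.
apply: (expect_wconvs_eq_le _ (@lex_group_order R d)) => // [i|||].
- exact: wnonneg_atoms.
- exact: wnonneg_wunif.
- move=> i; apply: (unif_concentrated (@lex_group_order R d) aN).
  + exact: wnonneg_atoms.
  + by move=> y; apply: expect_atoms_eq_le => //; rewrite ltW.
  + rewrite /expect big_map /=; under eq_bigr do rewrite mulr1.
    exact: atoms_mass_le.
- exact: wunif_self_concentrated.
Qed.
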